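(* For all sufficiently large $n$, the systole of the Löbell orbifold $\mathbb{H}^3/\Gamma_n$ is precisely $2\delta_n$, where $\delta_n$ is the hyperbolic distance between the top and bottom faces of the Löbell polyhedron $L_n$.
   Context: For $n \geq 5$, consider the combinatorial $3$-polyhedron with $2n+2$ faces whose ''top'' and ''bottom'' faces are $n$-gons and whose lateral surface consists of $2n$ pentagons: $n$ upper pentagons $U_i$ and $n$ lower pentagons $V_i$ ($i \in \mathbb{Z}/n$), where $U_i$ is adjacent to the top face, $U_{i\pm 1}$, $V_i$ and $V_{i+1}$, and $V_i$ is adjacent to the bottom face, $V_{i\pm1}$, $U_{i-1}$ and $U_i$. By Andreev's theorem it is realized, uniquely up to isometry, as a compact polyhedron $L_n \subset \mathbb{H}^3$ all of whose dihedral angles are $\pi/2$; this is the Löbell polyhedron $L_n$. Let $\Gamma_n < \mathrm{Isom}(\mathbb{H}^3)$ be the group generated by the reflections in the faces of $L_n$; it is a cocompact lattice, and the quotient $\mathbb{H}^3/\Gamma_n$ is the Löbell orbifold (also denoted $L_n$). For a lattice $\Gamma < \mathrm{Isom}(\mathbb{H}^d)$, the systole of $\Gamma$, and of the orbifold $\mathbb{H}^d/\Gamma$, is the minimal translation length of a loxodromic element of $\Gamma$ (an isometry, possibly orientation-reversing, with positive translation length along an invariant axis). *)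

(* Defs.v *)
From mathcomp Require Import all_boot all_order all_algebra.
From mathcomp Require Import all_classical all_reals all_analysis.

Set Implicit Arguments.
Unset Strict Implicit.
Unset Printing Implicit Defensive.

Import Order.TTheory GRing.Theory Num.Theory.
Import numFieldNormedType.Exports.

Local Open Scope classical_set_scope.
Local Open Scope ring_scope.

(** Hyperbolic [d]-space is the upper sheet of the hyperboloid in the Minkowski
    space R^(d,1); coordinate [ord0] is the timelike one. Isometries of
    hyperbolic space are represented by the maps they induce on R^(d,1). *)

Section Hyperbolic.
Variables (R : realType) (d : nat).
Local Notation V := 'rV[R]_d.+1.

Definition lorentz (x y : V) : R :=
  - (x ord0 ord0 * y ord0 ord0)
  + \sum_(i < d) x ord0 (lift ord0 i) * y ord0 (lift ord0 i).

Definition hspace : set V :=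
  [set x | lorentz x x = -1 /\ 0 < x ord0 ord0].

Definition arcosh (t : R) : R := ln (t + Num.sqrt (t ^+ 2 - 1)).

Definition hdist (x y : V) : R := arcosh (- lorentz x y).

Definition set_dist (A B : set V) : R :=
  inf [set hdist p.1 p.2 | p in A `*` B].

Definition geodesic_line (gamma : R -> V) : Prop :=
  (forall t, hspace (gamma t)) /\
  (forall s t, hdist (gamma s) (gamma t) = `|s - t|).

(** [g] is loxodromic with translation length [l]; nothing is required of the
    orientation. *)
Definition loxodromic (g : V -> V) (l : R) : Prop :=
  0 < l /\
  exists2 gamma, geodesic_line gamma & forall t, g (gamma t) = gamma (t + l).

Inductive generated (S : set (V -> V)) : set (V -> V) :=
| generated_mem f : S f -> generated S f
| generated_id : generated S id
| generated_comp f g : generated S f -> generated S g -> generated S (f \o g)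
| generated_inv f g :
    generated S f -> cancel f g -> cancel g f -> generated S g.

Definition is_systole (Gamma : set (V -> V)) (s : R) : Prop :=
  (exists2 g, Gamma g & loxodromic g s) /\
  (forall g l, Gamma g -> loxodromic g l -> s <= l).

(** For [lorentz e e = 1], the reflection in the hyperplane orthogonal to [e]. *)
Definition reflection (e : V) : V -> V := fun x => x - (2 * lorentz x e) *: e.

(** A family [e] of outward unit normals describes the polyhedron cut out by
    the half-spaces [lorentz x (e a) <= 0]. *)
Section Polyhedron.
Variables (I : Type) (e : I -> V).

Definition polyhedron : set V :=
  [set x | hspace x /\ forall a, lorentz x (e a) <= 0].

Definition face (a : I) : set V :=
  [set x | polyhedron x /\ lorentz x (e a) = 0].

(** The last clause says that every [face a] has codimension exactly one and
    that distinct indices give distinct facets. The topology used by [compact]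
    is that of R^(d,1), which induces the metric topology on [hspace]. *)
Definition compact_polyhedron : Prop :=
  [/\ forall a, lorentz (e a) (e a) = 1,
      compact polyhedron,
      exists2 x, hspace x & forall a, lorentz x (e a) < 0 &
      forall a, exists2 x, face a x & forall b, b <> a -> lorentz x (e b) < 0].

(** The interior angle; the sign is due to the normals pointing outwards. *)
Definition dihedral_angle (a b : I) : R := acos (- lorentz (e a) (e b)).

Definition reflection_group : set (V -> V) :=
  generated (range (fun a => reflection (e a))).

End Polyhedron.
End Hyperbolic.

(** In dimension three, two distinct facets share an edge exactly when they
    have at least two points in common. *)
Definition adjacent (R : realType) (I : Type) (e : I -> 'rV[R]_4) (a b : I) :
    Prop :=
  a <> b /\
  exists x y, [/\ x <> y, (face e a `&` face e b) x & (face e a `&` face e b) y].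

Inductive lobell_face (n : nat) : Type :=
| Top | Bottom | Upper of 'I_n | Lower of 'I_n.
Arguments Top {n}.
Arguments Bottom {n}.

(** [ordS] is the cyclic successor on ['I_n]. *)
Definition lobell_adj (n : nat) (a b : lobell_face n) : bool :=
  match a, b with
  | Top, Upper _ | Upper _, Top => true
  | Bottom, Lower _ | Lower _, Bottom => true
  | Upper i, Upper j | Lower i, Lower j => (j == ordS i) || (i == ordS j)
  | Upper i, Lower j | Lower j, Upper i => (j == i) || (j == ordS i)
  | _, _ => false
  end.

(** The sides of a facet correspond to its adjacent facets, so the adjacency
    clause makes the top and bottom n-gons and the other facets pentagons. *)
Definition lobell_polyhedron (R : realType) (n : nat)
    (e : lobell_face n -> 'rV[R]_4) : Prop :=
  [/\ compact_polyhedron e,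
      forall a b, adjacent e a b <-> lobell_adj a b &
      forall a b, adjacent e a b -> dihedral_angle e a b = pi / 2].

(* Main.v *)
Require Import Defs.
From HB Require Import structures.
From mathcomp Require Import all_boot all_order all_algebra.
From mathcomp Require Import all_classical all_reals all_analysis.
From mathcomp Require Import ring lra zify.

Import Order.TTheory GRing.Theory Num.Theory.
Import numFieldNormedType.Exports.
Local Open Scope classical_set_scope.
Local Open Scope ring_scope.

Set Implicit Arguments.
Unset Strict Implicit.
Unset Printing Implicit Defensive.

(** Why the systole is twice the distance of the top and bottom facets.

    Write [C] for minus the product of the normals of these two facets; their
    planes are at distance [arcosh C]. The argument has a general half and one
    that is special to the Löbell polyhedra.

    In general, let a reflection group come from a compact polyhedron two of
    whose walls are either orthogonal or at distance at least [arcosh C]. The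
    axis of a loxodromic element [g] crosses some wall of the group
    ([crossing_wall]): otherwise the reflections could move it towards an
    interior point of the polyhedron forever. That wall and its image under [g]
    are in the orbit of one facet. Such walls are disjoint unless they
    coincide, and being both walls of no common chamber they are separated by
    a third wall, so they are at distance at least [2 * arcosh C]
    ([wall_dichotomy]); the axis has to cover that distance
    ([translation_length_ge]). Conversely, the product of the reflections in two
    facets at distance [arcosh C] translates by [2 * arcosh C]
    ([loxodromic_reflections]).

    It remains to see that disjoint facets of the Löbell polyhedron are at
    distance at least [arcosh C], and that the common perpendicular of the top
    and bottom planes ends on the two facets. The latter, as well as the fact
    that planes of nonadjacent facets are disjoint, holds for all right-angled
    compact polyhedra, because their Gram matrices are nonpositive off the
    diagonal ([gram_le0], [wall_separation], [set_dist_faces]).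

    The former requires all the distances, hence a proof that the polyhedron
    is the symmetric one. List the lateral facets in the cyclic order
    [V_0, U_0, V_1, U_1], and so on: facets one or two steps apart are
    orthogonal, so three consecutive facets meet in a vertex, and the whole
    band is determined by the lengths of the edges that join successive
    vertices. The existence of a plane orthogonal to all the upper facets, and
    of one orthogonal to all the lower facets, yields a quantity that is
    constant along the band, and a maximum principle then makes all these
    lengths equal ([invariant_constant], [band_rigid]). With [c] the hyperbolic
    cosine of the common length, all products of normals are expressed by
    Chebyshev polynomials in [c], and [C = c / (c ^ 2 - 2)]. As the facets
    that are a few steps apart are disjoint, these polynomials are positive,
    which bounds [c] from below ([band_cosh_bound]); this is enough to compare
    [C] with all other products. *)

(** * The Minkowski form *)

Section Minkowski.
Variables (R : realType) (d : nat).
Local Notation V := 'rV[R]_d.+1.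
Implicit Types x y z : V.

Lemma lorentzC x y : lorentz x y = lorentz y x.
Proof.
rewrite /lorentz mulrC; congr (_ + _).
by apply: eq_bigr => i _; rewrite mulrC.
Qed.

Lemma lorentzDl x y z : lorentz (x + y) z = lorentz x z + lorentz y z.
Proof.
rewrite /lorentz mxE mulrDl opprD addrACA -big_split /=; congr (_ + _).
by apply: eq_bigr => i _; rewrite mxE mulrDl.
Qed.

Lemma lorentzZl a x y : lorentz (a *: x) y = a * lorentz x y.
Proof.
rewrite /lorentz mxE -mulrA mulrDr mulrN; congr (_ + _).
by rewrite mulr_sumr; apply: eq_bigr => i _; rewrite mxE mulrA.
Qed.

Lemma lorentzNl x y : lorentz (- x) y = - lorentz x y.
Proof. by rewrite -scaleN1r lorentzZl mulN1r. Qed.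

Lemma lorentzBl x y z : lorentz (x - y) z = lorentz x z - lorentz y z.
Proof. by rewrite lorentzDl lorentzNl. Qed.

Lemma lorentzDr x y z : lorentz z (x + y) = lorentz z x + lorentz z y.
Proof. by rewrite lorentzC lorentzDl !(lorentzC z). Qed.

Lemma lorentzZr a x y : lorentz y (a *: x) = a * lorentz y x.
Proof. by rewrite lorentzC lorentzZl lorentzC. Qed.

Lemma lorentzNr x y : lorentz y (- x) = - lorentz y x.
Proof. by rewrite lorentzC lorentzNl lorentzC. Qed.

Lemma lorentzBr x y z : lorentz z (x - y) = lorentz z x - lorentz z y.
Proof. by rewrite lorentzDr lorentzNr. Qed.

Definition lorentzE :=
  (lorentzDl, lorentzBl, lorentzZl, lorentzNl,
   lorentzDr, lorentzBr, lorentzZr, lorentzNr).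

Lemma lorentz0l x : lorentz 0 x = 0.
Proof. by rewrite -(scale0r 0) lorentzZl mul0r. Qed.

Lemma lorentz_suml (I : Type) (r : seq I) (P : pred I) (F : I -> V) x :
  lorentz (\sum_(i <- r | P i) F i) x = \sum_(i <- r | P i) lorentz (F i) x.
Proof.
exact: (big_morph (fun y => lorentz y x) (fun y z => lorentzDl y z x)
  (lorentz0l x)).
Qed.

(** The vector [z_0 x - x_0 z] is spatial, so its square is nonnegative; all
    sign statements about the form come from expanding this square. *)
Lemma lorentz_lagrange x z :
  0 <= z ord0 ord0 ^+ 2 * lorentz x x + x ord0 ord0 ^+ 2 * lorentz z z
       - 2 * (x ord0 ord0 * z ord0 ord0) * lorentz x z.
Proof.
set w := z ord0 ord0 *: x - x ord0 ord0 *: z.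
have w0 : w ord0 ord0 = 0 by rewrite !mxE mulrC subrr.
have -> : z ord0 ord0 ^+ 2 * lorentz x x + x ord0 ord0 ^+ 2 * lorentz z z
  - 2 * (x ord0 ord0 * z ord0 ord0) * lorentz x z = lorentz w w.
  by rewrite !lorentzE (lorentzC z x); ring.
rewrite /lorentz w0 mulr0 oppr0 add0r; apply: sumr_ge0 => i _.
by rewrite -expr2 sqr_ge0.
Qed.

Lemma causal_time0 z : lorentz z z <= 0 -> z ord0 ord0 = 0 -> z = 0.
Proof.
rewrite {1}/lorentz => + z0; rewrite z0 mulr0 oppr0 add0r => zle.
have zi i : z ord0 (lift ord0 i) = 0.
  have /eqP : \sum_(j < d) z ord0 (lift ord0 j) * z ord0 (lift ord0 j) = 0.
    apply/eqP; rewrite eq_le zle sumr_ge0 // => j _.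
    by rewrite -expr2 sqr_ge0.
  rewrite psumr_eq0 => [/allP|j _]; last by rewrite -expr2 sqr_ge0.
  by move=> /(_ i (mem_index_enum _)); rewrite mulf_eq0 orbb => /eqP.
apply/rowP => i; rewrite mxE; by have [j ->|->] := unliftP ord0 i.
Qed.

Lemma timelike_time_neq0 x : lorentz x x < 0 -> x ord0 ord0 != 0.
Proof.
move=> x_lt0; apply/eqP => x0.
by have := x_lt0; rewrite (causal_time0 (ltW x_lt0) x0) lorentz0l ltxx.
Qed.

Lemma timelike_perp_ge0 x z :
  lorentz x x < 0 -> lorentz x z = 0 -> 0 <= lorentz z z.
Proof.
move=> x_lt0 xz; have := lorentz_lagrange x z; rewrite xz mulr0 subr0.
have x0 : 0 < x ord0 ord0 ^+ 2 by rewrite exprn_even_gt0 ?timelike_time_neq0.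
have := sqr_ge0 (z ord0 ord0).
by nra.
Qed.

Lemma timelike_perp_eq0 x z :
  lorentz x x < 0 -> lorentz x z = 0 -> lorentz z z <= 0 -> z = 0.
Proof.
move=> x_lt0 xz zz; apply: causal_time0 => //.
have := lorentz_lagrange x z; rewrite xz mulr0 subr0.
have x0 : 0 < x ord0 ord0 ^+ 2 by rewrite exprn_even_gt0 ?timelike_time_neq0.
have z0 := sqr_ge0 (z ord0 ord0) => le0.
by apply/eqP; rewrite -sqrf_eq0 eq_le z0 andbT; nra.
Qed.

Lemma reverse_cauchy_schwarz x w :
  lorentz x x < 0 -> lorentz x x * lorentz w w <= lorentz x w ^+ 2.
Proof.
move=> x_lt0; pose z := lorentz x x *: w - lorentz x w *: x.
have /(timelike_perp_ge0 x_lt0) : lorentz x z = 0.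
  by rewrite !lorentzE mulrC subrr.
have -> : lorentz z z = lorentz x x *
    (lorentz x x * lorentz w w - lorentz x w ^+ 2).
  by rewrite !lorentzE (lorentzC w x); ring.
by rewrite nmulr_rge0 // subr_le0.
Qed.

(** This makes the time orientation of a causal vector independent of the
    coordinates: it can be tested on any timelike vector. *)
Lemma same_orientation x y :
  lorentz x x < 0 -> 0 < x ord0 ord0 -> lorentz y y <= 0 -> y != 0 ->
  (lorentz x y < 0) = (0 < y ord0 ord0).
Proof.
move=> x_lt0 x0 yy yn0.
have y0 : y ord0 ord0 != 0 by apply: contra_neq yn0 => /(causal_time0 yy).
have := lorentz_lagrange x y.
have y2 : 0 < y ord0 ord0 ^+ 2 by rewrite exprn_even_gt0.
have x2 := sqr_ge0 (x ord0 ord0).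
set L := lorentz x y.
have [ygt|yle] := ltrP 0 (y ord0 ord0) => h.
  have : 0 < x ord0 ord0 * y ord0 ord0 by rewrite mulr_gt0.
  by nra.
have ylt : y ord0 ord0 < 0 by rewrite lt_neqAle y0.
have : x ord0 ord0 * y ord0 ord0 < 0 by rewrite pmulr_rlt0.
by move=> ?; apply/negbTE; rewrite -leNgt; nra.
Qed.

Lemma hspace_neg x y : hspace x -> lorentz y y <= 0 -> y != 0 ->
  (lorentz x y < 0) = (0 < y ord0 ord0).
Proof. by case=> xx x0; apply: same_orientation; rewrite // xx ltrN10. Qed.

Lemma hspace_neq0 x : hspace x -> x != 0.
Proof.
by case=> xx _; apply: contra_eq_neq xx => ->; rewrite lorentz0l eq_sym oppr_eq0 oner_neq0.
Qed.

Lemma hspace_lt0 x y : hspace x -> hspace y -> lorentz x y < 0.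
Proof.
move=> xH yH; rewrite hspace_neg ?hspace_neq0 //; last by case: yH => -> _.
by case: yH.
Qed.

Lemma hspace_leN1 x y : hspace x -> hspace y -> lorentz x y <= -1.
Proof.
move=> xH yH; have xy := hspace_lt0 xH yH.
case: xH yH => xx _ [yy _].
have := @reverse_cauchy_schwarz x y; rewrite xx yy => /(_ (ltrN10 _)).
by nra.
Qed.

Definition hnormalize y : V := (Num.sqrt (- lorentz y y))^-1 *: y.

Lemma hnormalize_scale_gt0 y :
  lorentz y y < 0 -> 0 < (Num.sqrt (- lorentz y y))^-1.
Proof. by move=> yy; rewrite invr_gt0 sqrtr_gt0 oppr_gt0. Qed.

Lemma hnormalize_hspace y :
  lorentz y y < 0 -> 0 < y ord0 ord0 -> hspace (hnormalize y).
Proof.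
move=> yy y0; split; last by rewrite mxE mulr_gt0 ?hnormalize_scale_gt0.
rewrite !lorentzE mulrA -expr2 exprVn sqr_sqrtr ?oppr_ge0 1?ltW//.
by rewrite invrN mulNr mulVf ?lt_eqF.
Qed.

(** The distance from [y] to the hyperplane of [r] bounds the distance from
    [y] to [x]. Its hyperbolic sine is the absolute value of [lorentz y r],
    and this is at least the square root of [c ^ 2 - 1] by the reverse
    Cauchy-Schwarz inequality for the component of [r] orthogonal to [r']. *)
Lemma wall_distance x y (r r' : V) (c : R) : hspace x -> hspace y ->
  lorentz r r = 1 -> lorentz r' r' = 1 -> lorentz x r = 0 -> lorentz y r' = 0 ->
  1 <= c -> c ^+ 2 <= lorentz r r' ^+ 2 -> c <= - lorentz x y.
Proof.
move=> xH yH rr rr' xr yr c1 crr.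
have xy := hspace_lt0 xH yH; case: (xH) (yH) => xx _ [yy _].
pose w := r - lorentz r r' *: r'; pose y' := y - lorentz y r *: r.
have := @reverse_cauchy_schwarz y w; have := @reverse_cauchy_schwarz x y'.
rewrite !lorentzE xx yy (lorentzC r' r) (lorentzC r y) rr rr' xr yr.
move=> /(_ (ltrN10 _)) h1 /(_ (ltrN10 _)) h2.
have : c ^+ 2 <= lorentz x y ^+ 2.
  have h3 : c ^+ 2 - 1 <= lorentz y r ^+ 2 by nra.
  by nra.
by nra.
Qed.

(** The wall of [s] separates those of [a] and [r], so that the distances to
    it add up, and [2 c ^ 2 - 1] is the hyperbolic cosine of [2 * arcosh c].
    Algebraically, the components of [a] and [r] orthogonal to [s] are timelike
    with the same orientation, which the points [x] and [y] serve to detect. *)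
Lemma separated_walls (a s r x y : V) (c : R) : 1 < c ->
  lorentz a a = 1 -> lorentz s s = 1 -> lorentz r r = 1 ->
  lorentz a s <= - c -> c <= lorentz s r ->
  hspace x -> lorentz x a = 0 -> lorentz x s <= 0 ->
  hspace y -> lorentz y r = 0 -> 0 <= lorentz y s ->
  lorentz a r <= - (2 * c ^+ 2 - 1).
Proof.
move=> c1 aa ss rr as_ sr xH xa xs yH yr ys.
pose p := a - lorentz a s *: s; pose q := r - lorentz s r *: s.
have pp : lorentz p p = 1 - lorentz a s ^+ 2.
  by rewrite !lorentzE (lorentzC s a) aa ss; ring.
have qq : lorentz q q = 1 - lorentz s r ^+ 2.
  by rewrite !lorentzE (lorentzC r s) rr ss; ring.
have pq : lorentz p q = lorentz a r - lorentz a s * lorentz s r.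
  by rewrite !lorentzE ss; ring.
have p_lt0 : lorentz p p < 0 by rewrite pp; nra.
have q_lt0 : lorentz q q < 0 by rewrite qq; nra.
have pn0 : p != 0 by apply: contraTneq p_lt0 => ->; rewrite lorentz0l ltxx.
have qn0 : q != 0 by apply: contraTneq q_lt0 => ->; rewrite lorentz0l ltxx.
have xp : lorentz x p < 0.
  rewrite lt_neqAle; apply/andP; split; last by rewrite !lorentzE xa; nra.
  apply: contra_neqN pn0 => /eqP xp.
  by apply: (@timelike_perp_eq0 x) => //; [case: xH => ->; rewrite ltrN10|exact: ltW].
have yq : lorentz y q < 0.
  rewrite lt_neqAle; apply/andP; split; last by rewrite !lorentzE yr; nra.
  apply: contra_neqN qn0 => /eqP yq.
  by apply: (@timelike_perp_eq0 y) => //; [case: yH => ->; rewrite ltrN10|exact: ltW].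
have pq_lt0 : lorentz p q < 0.
  have p0 : 0 < p ord0 ord0 by rewrite -(hspace_neg xH (ltW p_lt0) pn0).
  have q0 : 0 < q ord0 ord0 by rewrite -(hspace_neg yH (ltW q_lt0) qn0).
  by rewrite same_orientation // ltW.
have := reverse_cauchy_schwarz q p_lt0; rewrite pp qq => h.
have : (c ^+ 2 - 1) ^+ 2 <= lorentz p q ^+ 2.
  have h1 : c ^+ 2 - 1 <= lorentz a s ^+ 2 - 1 by nra.
  have h2 : c ^+ 2 - 1 <= lorentz s r ^+ 2 - 1 by nra.
  have h0 : 0 <= c ^+ 2 - 1 by nra.
  apply: le_trans h; rewrite expr2 -[X in _ <= X]mulrNN !opprB; exact: ler_pM.
rewrite -ler_sqrt; last by rewrite sqr_ge0.
rewrite !sqrtr_sqr ger0_norm; last by nra.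
rewrite ltr0_norm // pq => h3.
have : c * c <= - lorentz a s * lorentz s r by apply: ler_pM; lra.
by nra.
Qed.

(** Pairwise orthogonal vectors of nonzero square are independent, which
    [d + 2] vectors in dimension [d + 1] cannot be. *)
Lemma no_orthogonal_family (r : 'I_d.+2 -> V) :
  (forall i j, i != j -> lorentz (r i) (r j) = 0) ->
  exists i, lorentz (r i) (r i) = 0.
Proof.
move=> orth; pose M := \matrix_i r i.
have kn0 : kermx M != 0.
  rewrite -mxrank_eq0 mxrank_ker subn_eq0 -ltnNge.
  by rewrite (leq_ltn_trans (rank_leq_col _)).
have /rowV0Pn[k /sub_kermxP kM k0] := kn0.
have [i ki] : exists i, k ord0 i != 0.
  apply: contra_neqP k0 => /forallNP k0; apply/rowP => i; rewrite mxE.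
  by apply/eqP; apply: contra_notT (k0 i).
exists i; have := congr1 (fun v => lorentz v (r i)) kM.
rewrite /= lorentz0l mulmx_sum_row lorentz_suml (bigD1 i) //= big1 => [|j ji].
  by rewrite rowK lorentzZl addr0 => /eqP; rewrite mulf_eq0 (negbTE ki) => /eqP.
by rewrite rowK lorentzZl orth // mulr0.
Qed.

End Minkowski.

Lemma perp3 (R : realType) (x y z : 'rV[R]_4) :
  exists2 v, v != 0 & [/\ lorentz v x = 0, lorentz v y = 0 & lorentz v z = 0].
Proof.
pose w (j : 'I_3) := if val j == 0 then x else if val j == 1 then y else z.
pose G (j : 'I_3) (i : 'I_4) := lorentz (delta_mx ord0 i) (w j).
pose M : 'M[R]_(4, 3) := \matrix_(i, j) G j i.
have kn0 : kermx M != 0.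
  rewrite -mxrank_eq0 mxrank_ker subn_eq0 -ltnNge.
  by rewrite (leq_ltn_trans (rank_leq_col _)).
have /rowV0Pn[v /sub_kermxP vM v0] := kn0.
have vw j : lorentz v (w j) = 0.
  have := congr1 (fun m : 'rV_3 => m ord0 j) vM; rewrite !mxE => <-.
  rewrite {1}[v]row_sum_delta lorentz_suml; apply: eq_bigr => i _.
  by rewrite lorentzZl !mxE.
exists v => //; split.
- by have := vw ord0.
- by have := vw (lift ord0 ord0).
- by have := vw ord_max.
Qed.

(** * Distances and geodesics *)

Section HyperbolicFunctions.
Variable R : realType.
Implicit Types s t a b : R.

Definition cosh t : R := (expR t + expR (- t)) / 2.
Definition sinh t : R := (expR t - expR (- t)) / 2.

Lemma cosh0 : cosh 0 = 1.
Proof. by rewrite /cosh oppr0 expR0; field. Qed.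

Lemma coshN t : cosh (- t) = cosh t.
Proof. by rewrite /cosh opprK addrC. Qed.

Lemma sinhN t : sinh (- t) = - sinh t.
Proof. by rewrite /sinh opprK -mulNr opprB. Qed.

Lemma cosh_abs t : cosh `|t| = cosh t.
Proof. by case: ger0P => // _; rewrite coshN. Qed.

Lemma expRKN t : expR t * expR (- t) = 1.
Proof. by rewrite -expRD subrr expR0. Qed.

Lemma coshD s t : cosh (s + t) = cosh s * cosh t + sinh s * sinh t.
Proof. by rewrite /cosh /sinh opprD !expRD; field. Qed.

Lemma coshB s t : cosh (s - t) = cosh s * cosh t - sinh s * sinh t.
Proof. by rewrite coshD coshN sinhN mulrN. Qed.

Lemma sinhD s t : sinh (s + t) = sinh s * cosh t + cosh s * sinh t.
Proof. by rewrite /cosh /sinh opprD !expRD; field. Qed.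

Lemma sinhB s t : sinh (s - t) = sinh s * cosh t - cosh s * sinh t.
Proof. by rewrite sinhD coshN sinhN mulrN. Qed.

Lemma cosh_sinh t : cosh t ^+ 2 - sinh t ^+ 2 = 1.
Proof.
rewrite -(expRKN t) /cosh /sinh; by field.
Qed.

Lemma cosh_double t : cosh (2 * t) = 2 * cosh t ^+ 2 - 1.
Proof. by rewrite mulr_natl mulr2n coshD; have := cosh_sinh t; lra. Qed.

Lemma sinh_ge0 t : 0 <= t -> 0 <= sinh t.
Proof. by move=> t0; rewrite divr_ge0 // subr_ge0 ler_expR ge0_cp. Qed.

Lemma sinh_gt0 t : 0 < t -> 0 < sinh t.
Proof. by move=> t0; rewrite divr_gt0 // subr_gt0 ltr_expR gt0_cp. Qed.

Lemma cosh_gt0 t : 0 < cosh t.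
Proof. by rewrite divr_gt0 // addr_gt0 ?expR_gt0. Qed.

Lemma cosh_ge1 t : 1 <= cosh t.
Proof. by have := cosh_sinh t; have := cosh_gt0 t; have := sqr_ge0 (sinh t); nra. Qed.

Lemma arcosh_cosh t : 0 <= t -> arcosh (cosh t) = t.
Proof.
move=> t0; rewrite /arcosh.
have -> : cosh t ^+ 2 - 1 = sinh t ^+ 2 by have := cosh_sinh t; lra.
rewrite sqrtr_sqr ger0_norm ?sinh_ge0 //.
have -> : cosh t + sinh t = expR t by rewrite /cosh /sinh; field.
exact: expRK.
Qed.

Lemma cosh_arcosh a : 1 <= a -> cosh (arcosh a) = a.
Proof.
move=> a1; rewrite /cosh /arcosh.
set q := Num.sqrt _; have q0 : 0 <= q by exact: sqrtr_ge0.
have q2 : q ^+ 2 = a ^+ 2 - 1 by rewrite sqr_sqrtr //; nra.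
have aq : 0 < a + q by lra.
rewrite expRN lnK ?posrE //.
have -> : (a + q)^-1 = a - q.
  by apply: (mulfI (lt0r_neq0 aq)); rewrite mulfV ?lt0r_neq0 //; nra.
by field.
Qed.

Lemma arcosh_ge0 a : 1 <= a -> 0 <= arcosh a.
Proof.
move=> a1; rewrite /arcosh ln_ge0 // (le_trans a1) // lerDl; exact: sqrtr_ge0.
Qed.

Lemma le_arcosh a b : 1 <= a -> a <= b -> arcosh a <= arcosh b.
Proof.
move=> a1 ab; rewrite /arcosh ler_ln ?posrE; last 2 first.
- by rewrite ltr_wpDr ?sqrtr_ge0 //; lra.
- by rewrite ltr_wpDr ?sqrtr_ge0 //; lra.
by rewrite lerD // ler_sqrt; nra.
Qed.

Lemma arcosh_gt0 a : 1 < a -> 0 < arcosh a.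
Proof.
move=> a1; rewrite lt_neqAle arcosh_ge0 ?(ltW a1) // andbT.
apply/eqP => a0; have := cosh_arcosh (ltW a1); rewrite -a0 cosh0 => ?; lra.
Qed.

Lemma le_cosh s t : 0 <= s -> 0 <= t -> cosh s <= cosh t -> s <= t.
Proof.
move=> s0 t0 /(le_arcosh (cosh_ge1 s)); by rewrite !arcosh_cosh.
Qed.

End HyperbolicFunctions.

Section Geodesics.
Variables (R : realType) (d : nat).
Local Notation V := 'rV[R]_d.+1.
Implicit Types x y p u v : V.

Lemma cosh_hdist x y : hspace x -> hspace y -> cosh (hdist x y) = - lorentz x y.
Proof.
by move=> xH yH; rewrite cosh_arcosh // lerNr hspace_leN1.
Qed.

Lemma geodesic_lorentz (gamma : R -> V) s t : geodesic_line gamma ->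
  lorentz (gamma s) (gamma t) = - cosh (s - t).
Proof.
by move=> [gH gd]; rewrite -cosh_abs -gd cosh_hdist // opprK.
Qed.

(** The distances between three points of the line make their Gram matrix
    degenerate: the component of [gamma t] orthogonal to [gamma 0] and
    [gamma 1] has square zero and is orthogonal to a timelike vector, so it
    vanishes. The null vectors [u] and [v] are the two ends of the line. *)
Lemma geodesic_ends (gamma : R -> V) : geodesic_line gamma ->
  exists u v, [/\ lorentz u u = 0, lorentz v v = 0, lorentz u v = - 2^-1 &
    forall t, gamma t = expR t *: u + expR (- t) *: v].
Proof.
move=> geo; have gl s t := geodesic_lorentz s t geo.
have [gH _] := geo.
have s1 : sinh (1 : R) != 0 by rewrite gt_eqF ?sinh_gt0.
have span t : sinh 1 *: gamma t = sinh (1 - t) *: gamma 0 + sinh t *: gamma 1.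
  apply/eqP; rewrite -subr_eq0; apply/eqP.
  have cs1 := cosh_sinh (1 : R); have cst := cosh_sinh t.
  apply: (@timelike_perp_eq0 _ _ (gamma 0)).
  - by rewrite gl subrr cosh0 ltrN10.
  - rewrite !lorentzE !gl !sub0r !coshN ?subrr ?cosh0 sinhB. ring.
  rewrite !lorentzE !gl !subr0 !sub0r !coshN subrr cosh0.
  rewrite -[t - 1]opprB coshN !sinhB !coshB.
  move: (cosh 1) (sinh 1) (cosh t) (sinh t) cs1 cst => C S c s h1 h2.
  rewrite -!expr2 h1 [leLHS](_ : _ = S ^+ 2 * (c ^+ 2 - s ^+ 2 - 1)
    + s ^+ 2 * (C ^+ 2 - S ^+ 2 - 1)); last by ring.
  by rewrite h1 h2 subrr !mulr0 addr0.
have E0 := expR_gt0 (1 : R); have EN := expRKN (1 : R).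
pose k := (2 * sinh (1 : R))^-1.
have k2 : k * (expR 1 - expR (- 1)) = 1.
  by rewrite /k /sinh mulrCA divff // mulr1 mulVf //; move: s1; rewrite /sinh mulf_eq0 negb_or => /andP[].
have glE (a b c e : R) : lorentz (a *: gamma 0 + b *: gamma 1)
    (c *: gamma 0 + e *: gamma 1) =
    - (a * c + b * e) - (a * e + b * c) * ((expR 1 + expR (- 1)) / 2).
  rewrite !lorentzE !gl !subr0 !sub0r coshN subrr cosh0 /cosh; ring.
exists (- (k * expR (- 1)) *: gamma 0 + k *: gamma 1).
exists ((k * expR 1) *: gamma 0 + - k *: gamma 1).
rewrite !glE.
split; last 1 first.
  move=> t; apply: (scalerI s1); rewrite span sinhB !scalerDr !scalerA.
  rewrite addrACA -!scalerDl /sinh /cosh.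
  move: (expR t) (expR (- t)) (expR 1) (expR (- 1)) k k2 => a b E F k k2.
  congr (_ *: _ + _ *: _).
  - transitivity (k * (E - F) * ((b * E - a * F) / 2)); last by field.
    by rewrite k2 mul1r; field.
  - transitivity (k * (E - F) * ((a - b) / 2)); last by field.
    by rewrite k2 mul1r; field.
all: move: (expR 1) (expR (- 1)) k k2 EN => E F k k2 EN.
- have -> : - (- (k * F) * - (k * F) + k * k) - (- (k * F) * k + k * - (k * F)) * ((E + F) / 2) = k ^+ 2 * (E * F - 1) by field.
  by rewrite EN subrr mulr0.
- have -> : - (k * E * (k * E) + - k * - k) - (k * E * - k + - k * (k * E)) * ((E + F) / 2) = k ^+ 2 * (E * F - 1) by field.
  by rewrite EN subrr mulr0.
- have -> : - (- (k * F) * (k * E) + k * - k) - (- (k * F) * - k + k * (k * E)) * ((E + F) / 2) =  k ^+ 2 * (1 - E * F) - (k * (E - F)) ^+ 2 / 2 by field.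
  by rewrite EN subrr mulr0 k2; field.
Qed.

Lemma geodesic_through p e : hspace p -> lorentz p e = 0 -> lorentz e e = 1 ->
  geodesic_line (fun t => cosh t *: p - sinh t *: e).
Proof.
move=> pH pe ee; have [pp p0] := pH.
have gl s t : lorentz (cosh s *: p - sinh s *: e) (cosh t *: p - sinh t *: e)
    = - cosh (s - t).
  by rewrite !lorentzE (lorentzC e p) pe pp ee coshB; ring.
split=> [t|s t]; last first.
  by rewrite /hdist gl opprK -cosh_abs arcosh_cosh.
split; first by rewrite gl subrr cosh0.
pose x := cosh t *: p - sinh t *: e.
have xx : lorentz x x = -1 by rewrite gl subrr cosh0.
rewrite -[_ - _]/x -(hspace_neg pH); first by rewrite !lorentzE pp pe; have := cosh_gt0 t; lra.
- by rewrite xx lerN10.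
- by apply: contra_eq_neq xx => ->; rewrite lorentz0l eq_sym oppr_eq0 oner_neq0.
Qed.

End Geodesics.

(** * The cone over a compact polyhedron *)

Lemma finite_pos_bound (R : realType) (I : finType) (f : I -> R) :
  (forall i, 0 < f i) -> exists2 m, 0 < m & forall i, m <= f i.
Proof.
move=> f0; exists (\big[Num.min/1]_i f i); first exact: lt_bigmin.
by move=> i; apply: bigmin_le_cond.
Qed.

Section Cone.
Variables (R : realType) (d : nat) (I : finType).
Local Notation V := 'rV[R]_d.+1.
Variable e : I -> V.
Hypothesis cpt : compact_polyhedron e.
Implicit Types x y z u : V.

Definition cone y := forall a, lorentz y (e a) <= 0.

Lemma unit_normal a : lorentz (e a) (e a) = 1.
Proof. by have [h _ _ _] := cpt; exact: h. Qed.

Lemma face_interior a : exists2 x, face e a x &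
  forall b, b <> a -> lorentz x (e b) < 0.
Proof. by have [_ _ _ h] := cpt; exact: h. Qed.

Lemma lorentz_continuous y : continuous (fun x => lorentz x y).
Proof.
have c0 (i : 'I_d.+1) : continuous (fun x : V => x ord0 i * y ord0 i).
  by move=> x; apply: (@cvgM _ _ (nbhs x)); [exact: coord_continuous|exact: cvg_cst].
have cN : continuous (fun x : V => - (x ord0 ord0 * y ord0 ord0)).
  by move=> x; exact: cvgN (c0 ord0 x).
suff cS : continuous (fun x : V =>
    \sum_(i < d) x ord0 (lift ord0 i) * y ord0 (lift ord0 i)).
  by move=> x; exact: cvgD (cN x) (cS x).
elim: (index_enum _) => [|i s ih] z.
  by under eq_fun do rewrite big_nil; exact: cst_continuous.
by under eq_fun do rewrite big_cons; exact: cvgD (c0 _ z) (ih z).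
Qed.

Lemma polyhedron_bounded x0 :
  exists2 M, 1 <= M & forall x, polyhedron e x -> - lorentz x x0 <= M.
Proof.
have [_ cp [z zH zlt] _] := cpt.
have L0 : polyhedron e !=set0 by exists z; split => // a; exact: ltW.
have fc : {within polyhedron e, continuous (fun x => - lorentz x x0)}.
  apply: continuous_subspaceT => x; exact: cvgN (@lorentz_continuous x0 x).
have [c _ cmax] := compact_EVT_max L0 cp fc.
exists (Num.max 1 (- lorentz c x0)); first by rewrite le_max lexx.
by move=> x xL; rewrite le_max cmax ?orbT // inE.
Qed.

Lemma cone_hnormalize y : cone y -> lorentz y y < 0 -> 0 < y ord0 ord0 ->
  polyhedron e (hnormalize y).
Proof.
move=> yK yy y0; split; first exact: hnormalize_hspace.
by move=> a; rewrite lorentzZl pmulr_rle0 // hnormalize_scale_gt0.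
Qed.

Section InteriorPoint.
Variables (a0 : I) (x0 : V).
Hypotheses (x0H : hspace x0) (x0_lt0 : forall a, lorentz x0 (e a) < 0).

Lemma cone_bound : exists2 M, 1 <= M & forall y, cone y -> lorentz y y < 0 ->
  lorentz x0 y < 0 -> lorentz x0 y ^+ 2 <= M * - lorentz y y.
Proof.
have [M M1 hM] := polyhedron_bounded x0; exists (M ^+ 2); first by rewrite exprn_ege1.
move=> y yK yy xy; have y0 : 0 < y ord0 ord0.
  rewrite -(hspace_neg x0H (ltW yy)) //.
  by apply: contraTneq yy => ->; rewrite lorentz0l ltxx.
have := hM _ (cone_hnormalize yK yy y0).
set q := Num.sqrt (- lorentz y y); have q0 : 0 < q by rewrite sqrtr_gt0 oppr_gt0.
have q2 : q ^+ 2 = - lorentz y y by rewrite sqr_sqrtr // oppr_ge0 ltW.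
rewrite lorentzZl -mulrN -/q ler_pdivrMl // (lorentzC y) => h.
rewrite -q2 -sqrrN -exprMn mulrC lerXn2r // nnegrE ?oppr_ge0 1?ltW //.
by rewrite mulr_gt0 //; lra.
Qed.

(** Compactness makes every nonzero vector of the cone timelike: otherwise the
    ray from [x0] in its direction would approach the light cone, and its
    points would normalize to points of the polyhedron going to infinity. *)
Lemma cone_future y : cone y -> y != 0 -> lorentz y y < 0 /\ lorentz x0 y < 0.
Proof.
move=> yK yn0; have [xx _] := x0H; have [M M1 hM] := cone_bound.
pose b := - lorentz x0 y; pose w := y - b *: x0.
have xw : lorentz x0 w = 0 by rewrite !lorentzE xx /b; ring.
pose E := lorentz w w.
have yyE : lorentz y y = E - b ^+ 2.
  by rewrite /E !lorentzE xx (lorentzC y x0) /b; ring.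
have x_lt0 : lorentz x0 x0 < 0 by rewrite xx ltrN10.
have E0 : 0 <= E by exact: timelike_perp_ge0 x_lt0 xw.
have [Ez|En0] := eqVneq E 0.
  have /eqP : w = 0 by apply: (timelike_perp_eq0 x_lt0 xw); rewrite -/E Ez.
  rewrite subr_eq0 => /eqP yb.
  have bn0 : b != 0 by apply: contra_neq yn0 => b0; rewrite yb b0 scale0r.
  have b0 : 0 < b.
    rewrite lt_neqAle eq_sym bn0 /=; have := yK a0; rewrite yb lorentzZl.
    by rewrite nmulr_lle0.
  by split; [rewrite yyE Ez sub0r oppr_lt0 exprn_gt0|rewrite -oppr_gt0].
have Egt : 0 < E by rewrite lt_neqAle eq_sym En0.
pose q := Num.sqrt E; have q0 : 0 < q by rewrite sqrtr_gt0.
have q2 : q ^+ 2 = E by rewrite sqr_sqrtr.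
have [bq|qb] := lerP b q; last first.
  have b0 : 0 < b by exact: lt_trans qb.
  split; last by rewrite -oppr_gt0.
  by rewrite yyE -q2; nra.
exfalso.
(* s makes the hyperbolic tangent of the distance from x0 to the point
   x0 + s y, once normalized, equal to l, which is too close to 1 for M *)
pose h := (4 * M)^-1; have h0 : 0 < h by rewrite invr_gt0; lra.
have hM1 : 4 * M * h = 1 by rewrite mulfV //; apply: lt0r_neq0; lra.
have h1 : h <= 4^-1 by rewrite lef_pV2 ?posrE; lra.
pose l := 1 - h.
have lb : 0 < q - l * b.
  have [b0|b0] := lerP 0 b; rewrite /l; nra.
pose s := l / (q - l * b).
have s0 : 0 < s by rewrite divr_gt0 // /l; lra.
have sE : s * (q - l * b) = l by rewrite divfK // gt_eqF.
pose z := x0 + s *: y.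
have zK : cone z.
  by move=> a; rewrite !lorentzE; have := x0_lt0 a; have := yK a; nra.
have xz : - lorentz x0 z = 1 + s * b by rewrite !lorentzE xx /b; ring.
have zz : lorentz z z = - (1 + s * b) ^+ 2 + (s * q) ^+ 2.
  rewrite !lorentzE xx (lorentzC y x0) yyE exprMn q2 /b; ring.
have sq : s * q = l * (1 + s * b) by nra.
have pos : 0 < 1 + s * b.
  have : 0 < s * q by rewrite mulr_gt0.
  rewrite sq pmulr_rgt0 // /l; lra.
have := hM z zK; rewrite zz sq.
have -> : lorentz x0 z = - (1 + s * b) by rewrite -xz opprK.
move: (1 + s * b) pos => t t0.
have t2 : 0 < t ^+ 2 by rewrite exprn_gt0.
have l2 : l ^+ 2 < 1 by rewrite /l; nra.
have zz0 : - t ^+ 2 + (l * t) ^+ 2 < 0 by rewrite exprMn; nra.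
move=> /(_ zz0); rewrite oppr_lt0 => /(_ t0); rewrite sqrrN exprMn.
have -> : M * - (- t ^+ 2 + l ^+ 2 * t ^+ 2) = M * (1 - l ^+ 2) * t ^+ 2 by ring.
have Ml : M * (1 - l ^+ 2) < 1 by rewrite /l; nra.
by rewrite ler_pMl // leNgt Ml.
Qed.

(** A null vector [u] is well outside the cone: by [cone_bound], so is
    [u + k p x0] for a small multiple of [p = - lorentz x0 u], and the
    reflection in a facet that this vector violates lowers [p] by a definite
    proportion. *)
Lemma null_descent : exists2 q, 0 < q < 1 & forall u,
  lorentz u u = 0 -> lorentz x0 u < 0 ->
  exists2 a, 0 < lorentz u (e a) &
    q * lorentz x0 u >= 2 * lorentz u (e a) * lorentz x0 (e a).
Proof.
have [xx _] := x0H; have [M M1 hM] := cone_bound.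
have [m m0 hm] : exists2 m, 0 < m & forall a, m <= - lorentz x0 (e a).
  by apply: finite_pos_bound => a; rewrite oppr_gt0.
pose k := (4 * M)^-1; have k0 : 0 < k by rewrite invr_gt0; lra.
have kM : 4 * M * k = 1 by rewrite mulfV //; apply: lt0r_neq0; lra.
exists (Num.min (2 * k * m ^+ 2) 2^-1).
  rewrite lt_min gt_min; apply/andP; split; last by apply/orP; right; lra.
  by rewrite invr_gt0 ltr0n !mulr_gt0 ?exprn_gt0.
move=> u uu xu; pose p := - lorentz x0 u; have p0 : 0 < p by rewrite oppr_gt0.
have [a ha] : exists a, k * p * - lorentz x0 (e a) < lorentz u (e a).
  apply: contrapT => /forallNP hn.
  pose y := u + (k * p) *: x0.
  have yK : cone y.
    move=> a; rewrite !lorentzE.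
    have /negP := hn a; rewrite -leNgt; lra.
  have kp : 0 < k * p by rewrite mulr_gt0.
  have yy : lorentz y y = - (k ^+ 2 + 2 * k) * p ^+ 2.
    by rewrite !lorentzE uu xx (lorentzC u) /p; ring.
  have xy : lorentz x0 y = - (1 + k) * p by rewrite !lorentzE xx /p; ring.
  have p2 : 0 < p ^+ 2 by rewrite exprn_gt0.
  have := hM y yK; rewrite yy xy.
  have h1 : - (k ^+ 2 + 2 * k) * p ^+ 2 < 0 by nra.
  have h2 : - (1 + k) * p < 0 by nra.
  move=> /(_ h1 h2).
  have -> : M * - (- (k ^+ 2 + 2 * k) * p ^+ 2) = M * (k ^+ 2 + 2 * k) * p ^+ 2.
    by ring.
  rewrite exprMn ler_pM2r //; nra.
have ma := hm a.
have kp : 0 < k * p by rewrite mulr_gt0.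
have ua : 0 < lorentz u (e a) by apply: lt_trans ha; rewrite mulr_gt0 //; lra.
exists a => //.
have h1 : Num.min (2 * k * m ^+ 2) 2^-1 <= 2 * k * m ^+ 2 by rewrite ge_min lexx.
have h2 : Num.min (2 * k * m ^+ 2) 2^-1 * p <= 2 * k * m ^+ 2 * p by rewrite ler_pM2r.
have h3 : k * p * (m * m) <= k * p * (- lorentz x0 (e a) * - lorentz x0 (e a)).
  by rewrite ler_pM2l // ler_pM // ltW.
have h4 : k * p * - lorentz x0 (e a) * - lorentz x0 (e a) <=
    lorentz u (e a) * - lorentz x0 (e a).
  by rewrite ler_pM2r ?(ltW ha) //; lra.
move: h2 h3 h4; rewrite /p; set mn := Num.min _ _; nra.
Qed.

End InteriorPoint.
End Cone.

(** * Facets of right-angled polyhedra in dimension three *)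

Local Notation adjacent := Defs.adjacent.

Section RightAngled.
Variables (R : realType) (I : finType).
Local Notation V := 'rV[R]_4.
Variable e : I -> V.
Hypothesis cpt : compact_polyhedron e.
Hypothesis right_angled : forall a b, adjacent e a b -> lorentz (e a) (e b) = 0.
Implicit Types x y z u v q : V.

Lemma interior_point :
  exists2 x, hspace x & forall a, lorentz x (e a) < 0.
Proof. by have [_ _ h _] := cpt. Qed.

Lemma cone_timelike (a : I) y : cone e y -> y != 0 ->
  lorentz y y < 0 /\ 0 < y ord0 ord0.
Proof.
move=> yK yn0; have [x xH xlt] := interior_point.
have [yy xy] := cone_future cpt a xH xlt yK yn0.
by split; rewrite // -(hspace_neg xH (ltW yy)).
Qed.

Lemma adjacent_cone (a b : I) y z : a <> b -> cone e y -> cone e z ->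
  lorentz y (e a) = 0 -> lorentz y (e b) = 0 ->
  lorentz z (e a) = 0 -> lorentz z (e b) = 0 ->
  z != 0 -> (forall l, y <> l *: z) -> adjacent e a b.
Proof.
move=> ab yK zK ya yb za zb zn0 yz.
have yn0 : y != 0 by apply/eqP => y0; apply: (yz 0); rewrite scale0r.
have [yy y0] := cone_timelike a yK yn0; have [zz z0] := cone_timelike a zK zn0.
split=> //; exists (hnormalize y), (hnormalize z); split.
- rewrite /hnormalize => eq; apply: (yz (Num.sqrt (- lorentz y y) *
    (Num.sqrt (- lorentz z z))^-1)).
  rewrite -scalerA -eq scalerA mulfV ?scale1r //.
  by rewrite gt_eqF // sqrtr_gt0 oppr_gt0.
- by split; split; rewrite ?lorentzZl ?ya ?yb ?mulr0 //; exact: cone_hnormalize.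
- by split; split; rewrite ?lorentzZl ?za ?zb ?mulr0 //; exact: cone_hnormalize.
Qed.

(** The facet [a] is cut out of its hyperplane by the adjacent facets alone.
    Coming from a point [x] inside the facet in a direction [q] that violates
    some facet [b], one leaves the polyhedron through a facet [d]; this is done
    from many points [x + t v], so that some [d] serves two of them and then
    meets the facet [a] in two points. *)
Lemma exit_facet (a b : I) x q : face e a x ->
  (forall c, c <> a -> lorentz x (e c) < 0) ->
  lorentz q (e a) = 0 -> lorentz x q < 0 -> a <> b -> 0 < lorentz q (e b) ->
  exists2 d, adjacent e a d & 0 < lorentz q (e d).
Proof.
move=> [[xH xL] xa] xlt qa xq ab qb; have [xx _] := xH.
have [v vn0 [va vx vq]] := perp3 (e a) x q.
have vv : 0 < lorentz v v.
  rewrite ltNge; apply: contra vn0 => vv; apply/eqP.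
  by apply: (@timelike_perp_eq0 _ _ x) => //; rewrite ?xx ?ltrN10 // lorentzC.
have [tau tau0 htau] : exists2 tau : R, 0 < tau &
    forall c, c <> a -> tau * `|lorentz v (e c)| < - lorentz x (e c).
  pose f c := if c == a then 1 else - lorentz x (e c) / (`|lorentz v (e c)| + 1).
  have f0 c : 0 < f c.
    rewrite /f; case: eqVneq => // /eqP ca.
    by rewrite divr_gt0 ?oppr_gt0 ?xlt // ltr_wpDl.
  have [m m0 hm] := finite_pos_bound f0; exists m => // c ca.
  have := hm c; rewrite /f; case: eqVneq => // _.
  rewrite ler_pdivlMr ?ltr_wpDl // => h; apply: lt_le_trans h.
  by rewrite ltr_pM2l // ltrDl.
pose p t := x + t *: v.
have plt (t : R) : 0 < t <= tau -> forall c, c <> a -> lorentz (p t) (e c) < 0.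
  move=> /andP[t0 tt] c /htau; rewrite !lorentzE => h.
  have : t * lorentz v (e c) <= tau * `|lorentz v (e c)|.
    apply: (@le_trans _ _ (t * `|lorentz v (e c)|)).
      by rewrite ler_pM2l // ler_norm.
    by rewrite ler_wpM2r.
  lra.
have exit (t : R) : 0 < t <= tau -> exists d, exists s,
    [/\ d <> a, 0 < lorentz q (e d), lorentz (p t + s *: q) (e d) = 0 &
        cone e (p t + s *: q)].
  move=> /plt pt.
  pose F c := - lorentz (p t) (e c) / lorentz q (e c).
  pose P := [pred c | (c != a) && (0 < lorentz q (e c))].
  have Pb : P b by rewrite /= qb andbT; apply/eqP => /esym.
  case: (arg_minP F Pb) => d /andP[/eqP da qd] dmin.
  exists d, (F d); split=> //.
    by rewrite lorentzDl lorentzZl /F divfK ?gt_eqF // addrN.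
  have Fd : 0 < F d by rewrite divr_gt0 // oppr_gt0 pt.
  move=> c; rewrite lorentzDl lorentzZl.
  have [->|/eqP ca] := eqVneq c a; first by rewrite !lorentzE xa va qa !mulr0 !addr0.
  have [qc|qc] := lerP (lorentz q (e c)) 0.
    by have := pt c ca; nra.
  have := dmin c; rewrite /= (introN eqP ca) qc => /(_ isT).
  by rewrite {2}/F ler_pdivlMr //; lra.
pose N := #|I|.+1.
pose t (j : 'I_N) : R := tau / (val j).+1%:R.
have t_in j : 0 < t j <= tau.
  rewrite divr_gt0 ?ltr0n //= ler_pdivrMr ?ltr0n // ler_peMr ?ler1n //.
  exact: ltW.
have t_inj : injective t.
  move=> j k /(mulfI (lt0r_neq0 tau0)) /invr_inj /eqP.
  by rewrite eqr_nat => /eqP[/val_inj].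
have [D hD] := fin_all_exists (fun j => exit (t j) (t_in j)).
have [j [k [jk Djk]]] : exists j, exists k, j <> k /\ D j = D k.
  apply: contrapT => hn.
  have /leq_card : injective D.
    by move=> j k Djk; apply: contrapT => jk; apply: hn; exists j, k.
  by rewrite card_ord ltnn.
have [s [da qd pd pK]] := hD j; have [s' [_ _ pd' pK']] := hD k.
exists (D j) => //; apply: (@adjacent_cone _ _ _ _ _ pK pK') => //.
- by move=> /esym.
- by rewrite !lorentzE xa va qa !mulr0 !addr0.
- by rewrite !lorentzE xa va qa !mulr0 !addr0.
- by rewrite Djk.
- have /andP[tk0 _] := t_in k.
  apply: contraTneq tk0 => /(congr1 (fun y => lorentz y v)).
  rewrite lorentz0l !lorentzE (lorentzC x) (lorentzC q) vx vq mulr0 add0r addr0.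
  by move=> /eqP; rewrite mulf_eq0 (gt_eqF vv) orbF => /eqP ->; rewrite ltxx.
move=> l eq.
have tt : t j = l * t k.
  have := congr1 (fun y => lorentz y v) eq.
  rewrite /= !lorentzE (lorentzC x) (lorentzC q) vx vq !mulr0 !add0r !addr0 mulrA.
  exact: (mulIf (lt0r_neq0 vv)).
have [l1|l1] := eqVneq l 1; first by apply: jk; apply: t_inj; rewrite tt l1 mul1r.
pose r : R := 1 - l; pose m : R := l * s' - s.
have xqE : r *: x = m *: q.
  apply/rowP => i; have := congr1 (fun y : V => y ord0 i) eq.
  by rewrite !mxE tt /r /m; nra.
(* x is then a multiple of q, a positive one as both lie in the future *)
have h1 := congr1 (fun y => lorentz y x) xqE.
have h2 := congr1 (fun y => lorentz y (e b)) xqE.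
have xb := xlt b (nesym ab).
rewrite /= !lorentzZl xx (lorentzC q x) in h1; rewrite /= !lorentzZl in h2.
have r2 : 0 < r ^+ 2 by rewrite exprn_even_gt0 //= subr_eq0 eq_sym l1.
clearbody r m.
have rE : r = - (m * lorentz x q) by lra.
have : r ^+ 2 * lorentz x (e b) = m ^+ 2 * (- lorentz x q * lorentz q (e b)).
  by rewrite expr2 -mulrA h2 rE; ring.
have : 0 <= m ^+ 2 * (- lorentz x q * lorentz q (e b)).
  by rewrite mulr_ge0 ?sqr_ge0 // mulr_ge0 1?ltW // oppr_gt0.
by have := r2; nra.
Qed.

(** Take an interior point of the facet [b] and project it to the hyperplane
    of [a]. This changes no product with a normal orthogonal to that of [a], so
    by [exit_facet] the projection stays in the polyhedron; its product with the
    normal of [b] gives the sign. *)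
Lemma gram_le0 (a b : I) : a <> b -> lorentz (e a) (e b) <= 0.
Proof.
move=> ab; have [x xF xlt] := face_interior cpt a.
have [z [[zH zL] zb] zlt] := face_interior cpt b.
rewrite leNgt; apply/negP => ab0.
pose q := z - lorentz z (e a) *: e a.
have za : lorentz z (e a) < 0 by exact: zlt.
have [zz _] := zH.
have qb : 0 < lorentz q (e b) by rewrite !lorentzE zb; nra.
have qa : lorentz q (e a) = 0.
  by rewrite !lorentzE (unit_normal cpt) mulr1 subrr.
have xq : lorentz x q < 0.
  have [[xH _] xa] := xF.
  by rewrite !lorentzE xa mulr0 subr0; exact: hspace_lt0.
have [d ad qd] := exit_facet xF xlt qa xq ab qb.
have := right_angled ad; move: qd; rewrite !lorentzE => + ad0.
by rewrite ad0 mulr0 subr0 ltNge zL.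
Qed.

(** If the product [c] of the normals were larger than [-1], their span would
    be definite. As the Gram matrix is nonpositive, the projection [pr] along
    this span would map the cone into itself, and its image would be a
    two-dimensional part of both facets. If [c] were [-1], the sum of the
    normals would be a null vector in the cone. *)
Lemma wall_separation (a b : I) : a <> b -> ~ adjacent e a b ->
  lorentz (e a) (e b) < -1.
Proof.
move=> ab nadj; have [x0 x0H x0lt] := interior_point.
have ab0 := gram_le0 ab; set c := lorentz (e a) (e b) in ab0 *.
have ea := unit_normal cpt a; have eb := unit_normal cpt b.
have gram d y : cone e y -> forall s t : R, s <= 0 -> t <= 0 -> d <> a -> d <> b ->
    lorentz (y - s *: e a - t *: e b) (e d) <= 0.
  move=> yK s t s0 t0 da db; rewrite !lorentzE.
  have h1 : lorentz (e a) (e d) <= 0 by apply: gram_le0 => /esym.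
  have h2 : lorentz (e b) (e d) <= 0 by apply: gram_le0 => /esym.
  by have := yK d; nra.
rewrite ltNge; apply/negP => c1.
have [c1'|cN1] := eqVneq c (-1).
  pose y := e a + e b.
  have yK : cone e y.
    move=> d; have [->|/eqP da] := eqVneq d a.
      by rewrite lorentzDl ea lorentzC -/c c1' subrr.
    have [->|/eqP db] := eqVneq d b; first by rewrite lorentzDl eb -/c c1' addNr.
    have K0 : cone e 0 by move=> a'; rewrite lorentz0l.
    have := gram d 0 K0 (-1) (-1) (lerN10 _) (lerN10 _) da db.
    by rewrite !lorentzE lorentz0l; lra.
  have yn0 : y != 0.
    apply/eqP => /(congr1 (lorentz x0)); rewrite (lorentzC x0 0) lorentz0l.
    by rewrite lorentzDr; have := x0lt a; have := x0lt b; lra.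
  have [yy _] := cone_timelike a yK yn0.
  by move: yy; rewrite !lorentzE (lorentzC (e b)) -/c c1' ea eb; lra.
have {}c1 : -1 < c by rewrite lt_neqAle eq_sym cN1.
pose A y := (lorentz y (e a) - c * lorentz y (e b)) / (1 - c ^+ 2).
pose B y := (lorentz y (e b) - c * lorentz y (e a)) / (1 - c ^+ 2).
pose pr y := y - A y *: e a - B y *: e b.
have c2 : 0 < 1 - c ^+ 2 by nra.
have pra y : lorentz (pr y) (e a) = 0.
  rewrite !lorentzE (lorentzC (e b)) -/c ea /A /B; field; exact: lt0r_neq0.
have prb y : lorentz (pr y) (e b) = 0.
  rewrite !lorentzE -/c eb /A /B; field; exact: lt0r_neq0.
have Ale0 y : cone e y -> A y <= 0.
  move=> yK; have ya := yK a; have yb := yK b.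
  by rewrite /A ler_pdivrMr // mul0r; nra.
have Ble0 y : cone e y -> B y <= 0.
  move=> yK; have ya := yK a; have yb := yK b.
  by rewrite /B ler_pdivrMr // mul0r; nra.
have prK y : cone e y -> cone e (pr y).
  move=> yK d; have [->|/eqP da] := eqVneq d a; first by rewrite pra.
  have [->|/eqP db] := eqVneq d b; first by rewrite prb.
  by apply: gram => //; [exact: Ale0|exact: Ble0].
have [v vn0 [va vb vx]] := perp3 (e a) (e b) x0.
have vv : 0 < lorentz v v.
  rewrite ltNge; apply: contra vn0 => vv; apply/eqP; have [xx _] := x0H.
  by apply: (@timelike_perp_eq0 _ _ x0) => //; rewrite ?xx ?ltrN10 // lorentzC.
have [tau tau0 htau] : exists2 tau : R, 0 < tau & cone e (x0 + tau *: v).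
  pose f d := - lorentz x0 (e d) / (`|lorentz v (e d)| + 1).
  have f0 d : 0 < f d by rewrite divr_gt0 ?oppr_gt0 // ltr_wpDl.
  have [m m0 hm] := finite_pos_bound f0; exists m => // d; rewrite !lorentzE.
  have := hm d; rewrite ler_pdivlMr ?ltr_wpDl // => h.
  have : m * lorentz v (e d) <= m * (`|lorentz v (e d)| + 1).
    by rewrite ler_pM2l // (le_trans (ler_norm _)) // lerDl.
  lra.
have x0K : cone e x0 by move=> d; exact: ltW.
have prv : lorentz (pr x0) v = 0.
  by rewrite !lorentzE (lorentzC x0) vx (lorentzC (e a)) va (lorentzC (e b)) vb; ring.
have prtv : lorentz (pr (x0 + tau *: v)) v = tau * lorentz v v.
  by rewrite !lorentzE (lorentzC x0) vx (lorentzC (e a)) va (lorentzC (e b)) vb; ring.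
apply: nadj; apply: (adjacent_cone ab (prK _ htau) (prK _ x0K)) => //.
  apply/eqP => pr0; have [xx _] := x0H.
  have : lorentz (pr x0) (pr x0) < 0.
    have -> : lorentz (pr x0) (pr x0) = lorentz (pr x0) x0.
      by rewrite {2}/pr !lorentzBr !lorentzZr pra prb !mulr0 !subr0.
    rewrite !lorentzE xx (lorentzC (e a)) (lorentzC (e b)).
    have := x0lt a; have := x0lt b.
    have := Ale0 _ x0K; have := Ble0 _ x0K; nra.
  by rewrite pr0 lorentz0l ltxx.
move=> l /(congr1 (fun y => lorentz y v)); rewrite /= lorentzZl prv mulr0 prtv.
by apply/eqP; rewrite mulf_neq0 // gt_eqF.
Qed.

End RightAngled.

(** * Reflection groups of polyhedra with orthogonal or disjoint walls *)

Section Reflections.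
Variables (R : realType) (d : nat).
Local Notation V := 'rV[R]_d.+1.
Implicit Types x y n : V.

Lemma reflectionZD n (a : R) x y :
  reflection n (a *: x + y) = a *: reflection n x + reflection n y.
Proof.
rewrite /reflection !lorentzE mulrDr scalerDl opprD addrACA scalerBr scalerA.
by rewrite mulrCA.
Qed.

Lemma reflectionN n x : reflection n (- x) = - reflection n x.
Proof. by rewrite /reflection lorentzNl mulrN scaleNr opprD. Qed.

Variable n : V.
Hypothesis nn : lorentz n n = 1.

Lemma lorentz_reflection x y :
  lorentz (reflection n x) (reflection n y) = lorentz x y.
Proof. by rewrite /reflection !lorentzE nn (lorentzC n y); ring. Qed.

Lemma reflectionK : involutive (reflection n).
Proof.
move=> x; rewrite /reflection !lorentzE nn mulr1 -addrA -opprD -scalerDl.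
have -> : 2 * lorentz x n + 2 * (lorentz x n - 2 * lorentz x n) = 0 by ring.
by rewrite scale0r subr0.
Qed.

Lemma reflection_normal : reflection n n = - n.
Proof.
rewrite /reflection nn mulr1 scaler_nat mulr2n opprD addrA subrr sub0r //.
Qed.

Lemma reflection_fix x : lorentz x n = 0 -> reflection n x = x.
Proof. by move=> xn; rewrite /reflection xn mulr0 scale0r subr0. Qed.

Lemma reflection_adj x y :
  lorentz (reflection n x) y = lorentz x (reflection n y).
Proof. by rewrite -lorentz_reflection reflectionK. Qed.

Lemma reflection_hspace x : hspace x -> hspace (reflection n x).
Proof.
move=> xH; have [xx x0] := xH.
have rr : lorentz (reflection n x) (reflection n x) = -1.
  by rewrite lorentz_reflection.
split=> //; rewrite -(hspace_neg xH) ?rr ?lerN10 //.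
  by rewrite /reflection !lorentzE xx; have := sqr_ge0 (lorentz x n); nra.
by apply: contra_eq_neq rr => ->; rewrite lorentz0l eq_sym oppr_eq0 oner_neq0.
Qed.

End Reflections.

Section Words.
Variables (R : realType) (d : nat) (I : Type) (e : I -> 'rV[R]_d.+1).
Local Notation V := 'rV[R]_d.+1.
Hypothesis unit : forall a, lorentz (e a) (e a) = 1.
Implicit Types (w : seq I) (x y : V).

Definition act w x : V := foldr (fun a => reflection (e a)) x w.

Lemma act_cat w1 w2 x : act (w1 ++ w2) x = act w1 (act w2 x).
Proof. by rewrite /act foldr_cat. Qed.

Lemma actZD w (a : R) x y : act w (a *: x + y) = a *: act w x + act w y.
Proof. by elim: w => //= s w ->; rewrite reflectionZD. Qed.

Lemma actZ w (a : R) x : act w (a *: x) = a *: act w x.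
Proof.
have act0 : act w 0 = 0.
  by have := actZD w (-1) 0 0; rewrite scaler0 addr0 scaleN1r addNr.
by have := actZD w a x 0; rewrite !addr0 act0 addr0.
Qed.

Lemma act_lorentz w x y : lorentz (act w x) (act w y) = lorentz x y.
Proof. by elim: w => //= s w ih; rewrite lorentz_reflection. Qed.

Lemma act_hspace w x : hspace x -> hspace (act w x).
Proof. by move=> xH; elim: w => //= s w; exact: reflection_hspace. Qed.

Lemma act_revK w : cancel (act w) (act (rev w)).
Proof.
move=> x; elim: w => //= s w ih.
by rewrite rev_cons -cats1 act_cat /= reflectionK.
Qed.

Lemma act_adj w x y : lorentz (act w x) y = lorentz x (act (rev w) y).
Proof. by rewrite -(act_lorentz (rev w)) act_revK. Qed.

Lemma reflection_groupP g : reflection_group e g -> exists w, g =1 act w.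
Proof.
elim=> [f [a _ <-]|//|f h _ [w fw] _ [w' hw]|f h _ [w fw] fK hK].
- by exists [:: a].
- by exists [::].
- by exists (w ++ w') => x /=; rewrite act_cat hw fw.
- by exists (rev w) => x; rewrite -{2}(hK x) fw act_revK.
Qed.

End Words.

Section Walls.
Variables (R : realType) (d : nat) (I : finType) (e : I -> 'rV[R]_d.+1) (C : R).
Local Notation V := 'rV[R]_d.+1.
Hypothesis cpt : compact_polyhedron e.
Hypothesis C1 : 1 < C.
Hypothesis gram : forall a b, a <> b ->
  lorentz (e a) (e b) = 0 \/ lorentz (e a) (e b) <= - C.
Implicit Types (w : seq I) (a b s : I) (x y : V).

Let unit := unit_normal cpt.

Lemma disjoint_walls a s x : lorentz (e a) (e s) <= - C -> hspace x ->
  0 <= lorentz x (e s) -> lorentz x (e a) < 0.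
Proof.
move=> as_ xH xs; have [_ _ [x0 x0H x0lt] _] := cpt.
set c := lorentz (e a) (e s) in as_ *.
have cN1 : c < -1 by have := C1; lra.
pose z := e s - c *: e a.
have zz : lorentz z z = 1 - c ^+ 2.
  by rewrite !lorentzE !unit (lorentzC (e s)) -/c; ring.
have zz0 : lorentz z z < 0 by rewrite zz; nra.
have zn0 : z != 0 by apply: contraTneq zz0 => ->; rewrite lorentz0l ltxx.
have x0z : lorentz x0 z < 0.
  by rewrite !lorentzE; have := x0lt a; have := x0lt s; nra.
have : lorentz x z < 0.
  by rewrite (hspace_neg xH (ltW zz0)) // -(hspace_neg x0H (ltW zz0)).
by rewrite !lorentzE; nra.
Qed.

(** Tits' alternative for a chamber and the wall of a facet. When two walls
    are disjoint, a chamber beyond the one is on the near side of the other, and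
    this ping-pong replaces the usual study of dihedral subgroups. *)
Lemma chamber_side w s :
  (forall z, polyhedron e z -> lorentz (act e w z) (e s) <= 0) \/
  (forall z, polyhedron e z -> 0 <= lorentz (act e w z) (e s)) /\
  exists2 w', (size w' < size w)%N &
    act e w =1 fun x => reflection (e s) (act e w' x).
Proof.
have [k] := ubnP (size w); elim: k w s => // k IH [|t w] s.
  by move=> _; left=> z [_]; exact.
rewrite /= ltnS => wk.
have := IH w t wk; case=> [wt|[_ [w' w'w wE]]]; last first.
  have w'k : (size w' < k)%N by apply: leq_trans wk; exact: ltnW.
  have wE' x : reflection (e t) (act e w x) = act e w' x.
    by rewrite wE reflectionK.
  case: (IH w' s w'k) => [ws|[ws [w2 w2w w2E]]]; [left|right].
    by move=> z zL; rewrite /= wE'; exact: ws.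
  split; first by move=> z zL; rewrite /= wE'; exact: ws.
  exists w2; last by move=> x; rewrite /= wE' w2E.
  by rewrite ltnS (leq_trans (ltnW w2w)) // ltnW.
have wt' z : polyhedron e z -> 0 <= lorentz (reflection (e t) (act e w z)) (e t).
  move=> zL; rewrite reflection_adj // reflection_normal // lorentzNr.
  by rewrite oppr_ge0 wt.
have [<-|st] := eqVneq t s.
  by right; split=> //; exists w.
have [ts|ts] := gram (elimN eqP st); last first.
  left=> z zL; apply: ltW; apply: (@disjoint_walls _ t).
  - by rewrite lorentzC.
  - apply: reflection_hspace => //; apply: act_hspace => //; by case: zL.
  - exact: wt'.
have fixs : reflection (e t) (e s) = e s by rewrite reflection_fix // lorentzC.
case: (IH w s wk) => [ws|[ws [w' w'w wE]]]; [left|right].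
  by move=> z zL; rewrite reflection_adj // fixs; exact: ws.
split; first by move=> z zL; rewrite reflection_adj // fixs; exact: ws.
exists (t :: w'); first by rewrite /= ltnS.
move=> x; rewrite /= wE /reflection !lorentzE ts (lorentzC (e s)) ts.
by rewrite !mulr0 !subr0 addrAC.
Qed.

(** Let [s] be the first letter of the word. It can be dropped, up to sign, if
    its wall equals that of [a] or is orthogonal to it, or if it is orthogonal
    to the second wall. If its wall is the second wall, the product is that of
    two normals of facets. Otherwise, for a word that [chamber_side] does not
    shorten, it separates the two walls and the distances to it add up. Two
    walls in the orbit of one facet can only coincide or be in this last case. *)
Lemma wall_dichotomy w a b (r := lorentz (e a) (act e w (e b))) :
  [\/ a = b /\ (act e w (e b) = e a \/ act e w (e b) = - e a),
      a <> b /\ r = 0 |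
      C ^+ 2 <= r ^+ 2 /\ (a = b -> (2 * C ^+ 2 - 1) ^+ 2 <= r ^+ 2)].
Proof.
have C0 : 0 <= C by have := C1; lra.
have CC : C <= 2 * C ^+ 2 - 1 by have := C1; nra.
rewrite /r {r}; have [k] := ubnP (size w); elim: k w a b => // k IH [|s w] a b.
  move=> _ /=; have [<-|/eqP ab] := eqVneq a b; first by constructor 1; split=> //; left.
  have [ab0|abC] := gram ab; first by constructor 2.
  by constructor 3; split=> //; have := C1; nra.
rewrite /= ltnS => wk.
have [<-|/eqP sa] := eqVneq s a.
  rewrite lorentzC reflection_adj // reflection_normal // lorentzNr (lorentzC _ (e s)).
  case: (IH w s b wk) => [[<- h]|[sb h]|[h1 h2]].
  - constructor 1; split=> //; case: h => ->; [right|left].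
      by rewrite reflection_normal.
    by rewrite reflectionN reflection_normal // opprK.
  - by constructor 2; rewrite h oppr0.
  - by constructor 3; rewrite sqrrN.
have [sa0|saC] := gram sa.
  have fixa : reflection (e s) (e a) = e a by rewrite reflection_fix // lorentzC.
  rewrite lorentzC reflection_adj // fixa (lorentzC _ (e a)).
  case: (IH w a b wk) => [[ab h]|[ab h]|[h1 h2]].
  - constructor 1; split=> //; case: h => ->; [left|right] => //.
    by rewrite reflectionN fixa.
  - by constructor 2.
  - by constructor 3.
case: (chamber_side w s) => [ws|[_ [w' w'w wE]]]; last first.
  have -> : reflection (e s) (act e w (e b)) = act e w' (e b).
    by rewrite wE reflectionK.
  exact: IH (ltn_trans w'w wk).
case: (IH w s b wk) => [[sb h]|[sb h]|[h1 _]].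
- constructor 3.
  have -> : lorentz (e a) (reflection (e s) (act e w (e b))) ^+ 2 = lorentz (e s) (e a) ^+ 2.
    rewrite lorentzC; case: h => ->; rewrite ?reflectionN reflection_normal //.
      by rewrite lorentzNl sqrrN.
    by rewrite opprK.
  split; last by rewrite -sb => /esym.
  by have := C1; nra.
- rewrite reflection_fix; last by rewrite lorentzC.
  exact: IH.
pose r := reflection (e s) (act e w (e b)).
have rr : lorentz r r = 1 by rewrite lorentz_reflection // act_lorentz // unit.
have sr : C ^+ 2 <= lorentz (e s) r ^+ 2.
  by rewrite lorentzC reflection_adj // reflection_normal // lorentzNr sqrrN lorentzC.
have [za [zaL za0] _] := face_interior cpt a.
have [zb [zbL zb0] _] := face_interior cpt b.
pose y := reflection (e s) (act e w zb).
have yH : hspace y by apply: reflection_hspace => //; apply: act_hspace => //; by case: zbL.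
have yr : lorentz y r = 0 by rewrite lorentz_reflection // act_lorentz.
have ys : 0 <= lorentz y (e s).
  by rewrite reflection_adj // reflection_normal // lorentzNr oppr_ge0 ws.
have zas : lorentz za (e s) <= 0 by case: zaL => _; exact.
have zaH : hspace za by case: zaL.
suff : (2 * C ^+ 2 - 1) ^+ 2 <= lorentz (e a) r ^+ 2.
  move=> h; constructor 3; split=> //; apply: le_trans h.
  by rewrite ler_sqr ?nnegrE // (le_trans C0 CC).
rewrite lorentzC in saC.
have key (t : V) : lorentz t t = 1 -> lorentz y t = 0 -> C <= lorentz (e s) t ->
    (2 * C ^+ 2 - 1) ^+ 2 <= lorentz (e a) t ^+ 2.
  move=> tt yt st.
  have := separated_walls C1 (unit a) (unit s) tt saC st zaH za0 zas yH yt ys.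
  move=> u; rewrite -[leRHS]sqrrN ler_sqr ?nnegrE; lra.
have [sr0|sr0] := lerP 0 (lorentz (e s) r).
  by apply: key; rewrite // -ler_sqr ?nnegrE.
have := key (- r); rewrite lorentzNl !lorentzNr opprK yr oppr0 sqrrN; apply=> //.
by rewrite -ler_sqr ?nnegrE ?oppr_ge0 ?(ltW sr0) // sqrrN.
Qed.

End Walls.

(** * Lower bound for translation lengths *)

Section TranslationLength.
Variables (R : realType) (d : nat) (I : finType) (e : I -> 'rV[R]_d.+1).
Local Notation V := 'rV[R]_d.+1.
Hypothesis cpt : compact_polyhedron e.
Implicit Types (w : seq I) (x y u v : V).

Let unit := unit_normal cpt.

Lemma null_product_bound x u v : hspace x -> lorentz u u = 0 ->
  lorentz v v = 0 -> lorentz x u < 0 -> lorentz x v < 0 ->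
  - lorentz u v <= 2 * (lorentz x u * lorentz x v).
Proof.
move=> [xx _] uu vv xu xv; set p := lorentz x u in xu *; set p' := lorentz x v in xv *.
(* the component of p' u + p v orthogonal to x *)
pose z := p' *: u + p *: v + (2 * (p * p')) *: x.
have xz : lorentz x z = 0 by rewrite !lorentzE -/p -/p' xx; ring.
have := timelike_perp_ge0 _ xz; rewrite xx => /(_ (ltrN10 _)).
rewrite !lorentzE !(lorentzC _ x) (lorentzC v u) uu vv xx -/p -/p'.
have pp : 0 < p * p' by nra.
move: (lorentz u v) => k.
rewrite [leRHS](_ : _ = 2 * (p * p') * (k + 2 * (p * p'))); last by ring.
rewrite pmulr_rge0; lra.
Qed.

(** A line that crosses no wall could be moved forever towards an interior
    point, by reflections that bring one end closer by a definite proportion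
    and the other one no further away; but the product of the two distances
    is bounded below. *)
Lemma crossing_wall u v : lorentz u u = 0 -> lorentz v v = 0 ->
  hspace (u + v) ->
  exists w a, lorentz (act e w u) (e a) * lorentz (act e w v) (e a) < 0.
Proof.
move=> uu vv pH; apply: contrapT => hn.
have nocross w a : 0 <= lorentz (act e w u) (e a) * lorentz (act e w v) (e a).
  by rewrite leNgt; apply/negP => h; apply: hn; exists w, a.
have uv : lorentz u v = - 2^-1.
  by have [] := pH; rewrite !lorentzE uu vv (lorentzC v u) => h _; lra.
have [_ _ [x0 x0H x0lt] _] := cpt.
have [q /andP[q0 q1] hq] := null_descent cpt x0H x0lt.
have future z w : lorentz z z = 0 -> lorentz (u + v) z < 0 ->
    lorentz x0 (act e w z) < 0.
  move=> zz pz.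
  have zz' : lorentz (act e w z) (act e w z) <= 0 by rewrite act_lorentz // zz.
  have pz' : lorentz (act e w (u + v)) (act e w z) < 0 by rewrite act_lorentz.
  have zn0 : act e w z != 0.
    by apply: contraTneq pz' => ->; rewrite lorentzC lorentz0l ltxx.
  by rewrite (hspace_neg x0H) // -(hspace_neg (act_hspace unit w pH)).
have fu w : lorentz x0 (act e w u) < 0.
  by apply: future => //; rewrite lorentzDl uu (lorentzC v) uv; lra.
have fv w : lorentz x0 (act e w v) < 0.
  by apply: future => //; rewrite lorentzDl vv uv; lra.
have descent k : exists w,
    (1 - q) ^+ k * lorentz x0 u <= lorentz x0 (act e w u) /\
    lorentz x0 v <= lorentz x0 (act e w v).
  elim: k => [|k [w [wu wv]]]; first by exists [::]; rewrite mul1r.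
  have uu' : lorentz (act e w u) (act e w u) = 0 by rewrite act_lorentz.
  have [a ua hqa] := hq _ uu' (fu w); exists (a :: w).
  have va : 0 <= lorentz (act e w v) (e a).
    by have := nocross w a; rewrite pmulr_rge0.
  have xa := x0lt a.
  rewrite /= /reflection !lorentzE; split.
    have : (1 - q) ^+ k.+1 * lorentz x0 u <= (1 - q) * lorentz x0 (act e w u).
      by rewrite exprS -mulrA ler_pM2l // subr_gt0.
    lra.
  have : lorentz (act e w v) (e a) * lorentz x0 (e a) <= 0 by nra.
  lra.
have bound k : 2^-1 <= (1 - q) ^+ k * (2 * (lorentz x0 u * lorentz x0 v)).
  have [w [wu wv]] := descent k.
  have uu' : lorentz (act e w u) (act e w u) = 0 by rewrite act_lorentz.
  have vv' : lorentz (act e w v) (act e w v) = 0 by rewrite act_lorentz.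
  have := null_product_bound x0H uu' vv' (fu w) (fv w).
  rewrite act_lorentz // uv opprK => h; apply: le_trans h _.
  have : - lorentz x0 (act e w u) * - lorentz x0 (act e w v) <=
      - ((1 - q) ^+ k * lorentz x0 u) * - lorentz x0 v.
    by apply: ler_pM; rewrite ?oppr_ge0 ?lerN2 // ltW.
  lra.
pose K := 2 * (lorentz x0 u * lorentz x0 v).
have K0 : 0 < K.
  by have := bound 0; rewrite mul1r -/K; lra.
have q2 : `|1 - q| < 1 by rewrite ger0_norm; lra.
have eps0 : 0 < (4 * K)^-1 by rewrite invr_gt0; lra.
have /cvgrPdist_lt /(_ _ eps0) [k _ /(_ k (leqnn k))] := cvg_expr q2.
rewrite /= sub0r normrN ger0_norm ?exprn_ge0 ?subr_ge0 ?ltW // => hk.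
have := bound k; rewrite -/K.
have : (1 - q) ^+ k * K < (4 * K)^-1 * K by rewrite ltr_pM2r.
have -> : (4 * K)^-1 * K = 4^-1 by field; exact: lt0r_neq0.
lra.
Qed.

(** A wall crossed by the axis and its translate lie in one orbit and are
    disjoint, so the axis needs at least the length [2 * arcosh C] to go from
    one to the other. *)
Lemma translation_length_ge (C : R) : 1 < C ->
  (forall a b, a <> b ->
    lorentz (e a) (e b) = 0 \/ lorentz (e a) (e b) <= - C) ->
  forall g l, reflection_group e g -> loxodromic g l -> 2 * arcosh C <= l.
Proof.
move=> C1 gram g l /(reflection_groupP unit)[w gw] [l0 [gamma geo gl]].
have [u [v [uu vv uv gE]]] := geodesic_ends geo.
have pH : hspace (u + v).
  have [gH _] := geo; have := gH 0.
  by rewrite gE oppr0 expR0 !scale1r.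
have [w1 [a cross]] := crossing_wall uu vv pH.
pose r := act e (rev w1) (e a).
have rE z : lorentz z r = lorentz (act e w1 z) (e a) by rewrite act_adj.
rewrite -!rE in cross.
set A := lorentz u r in cross; set B := lorentz v r in cross.
have An0 : A != 0 by apply: contraTneq cross => ->; rewrite mul0r ltxx.
have gr t : lorentz (gamma t) r = expR t * A + expR (- t) * B.
  by rewrite gE !lorentzE.
have BA : 0 < - B / A.
  have : 0 < A ^+ 2 by rewrite exprn_even_gt0.
  have -> : - B / A = (- (A * B)) / A ^+ 2 by field.
  by move=> A2; rewrite divr_gt0 // oppr_gt0.
pose t0 := ln (- B / A) / 2.
have E2 : expR t0 ^+ 2 = - B / A.
  by rewrite expr2 -expRD -splitr lnK.
have EN := expRKN t0; have E0 := expR_gt0 t0.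
have BE : B = - (expR t0 ^+ 2 * A) by rewrite E2 divfK // opprK.
have x0 : lorentz (gamma t0) r = 0.
  rewrite gr BE; transitivity (expR t0 * A * (1 - expR t0 * expR (- t0))).
    by ring.
  by rewrite EN subrr mulr0.
have y0 : lorentz (gamma (t0 + l)) (act e w r) = 0.
  by rewrite -gl gw act_lorentz.
have rr : lorentz r r = 1 by rewrite act_lorentz.
have [gH _] := geo.
case: (wall_dichotomy cpt C1 gram (w1 ++ w ++ rev w1) a a) => [[_ h]|[]//|[_ /(_ erefl) h]].
  have {}h : act e w r = r \/ act e w r = - r.
    have wE : act e w r = act e (rev w1) (act e (w1 ++ w ++ rev w1) (e a)).
      by rewrite !act_cat act_revK.
    case: h => h; rewrite wE h; [left|right] => //.
    by rewrite -scaleN1r actZ // scaleN1r.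
  have : lorentz (gamma (t0 + l)) r = 0.
    by case: h => h; move: y0; rewrite h // lorentzNr => /eqP; rewrite oppr_eq0 => /eqP.
  rewrite gr opprD !expRD BE.
  have L1 : 1 < expR l by rewrite expR_gt1.
  have LN := expRKN l.
  move=> h0; exfalso.
  have : expR t0 * A * (expR l ^+ 2 - 1) = 0.
    transitivity (expR l * (expR t0 * expR l * A +
       expR (- t0) * expR (- l) * - (expR t0 ^+ 2 * A)) +
       expR t0 * A * ((expR l * expR (- l)) * (expR t0 * expR (- t0)) - 1)).
      by ring.
    by rewrite h0 LN EN; ring.
  move/eqP; rewrite !mulf_eq0 (gt_eqF E0) (negbTE An0) /= subr_eq0.
  by rewrite gt_eqF // exprn_egt1.
have key : 2 * C ^+ 2 - 1 <= - lorentz (gamma t0) (gamma (t0 + l)).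
  apply: (@wall_distance _ _ _ _ r (act e w r)) => //.
  - by rewrite act_lorentz.
  - by nra.
  by rewrite act_adj // revK -!act_cat catA in h *.
have aC : 0 <= arcosh C by apply: arcosh_ge0; exact: ltW.
apply: le_cosh; [by rewrite mulr_ge0|exact: ltW|].
rewrite cosh_double cosh_arcosh; last exact: ltW.
move: key; rewrite (geodesic_lorentz _ _ geo) opprK => /le_trans; apply.
by rewrite -coshN opprB addrC addKr.
Qed.

End TranslationLength.

(** * Rigidity of the lateral band *)

Section MaximumPrinciple.
Variables (R : realType) (s c : nat -> R) (p : nat).
Hypotheses (p0 : (0 < p)%N) (s_per : forall k, s (k + p)%N = s k).
Hypotheses (s0 : forall k, 0 < s k) (c0 : forall k, 0 < c k).
Hypothesis cs : forall k, c k ^+ 2 = 1 + s k ^+ 2.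

Let F k := s k / c k * s k.+1 * (s k.+2 / c k.+2).

Lemma periodic_modn k : s k = s (k %% p)%N.
Proof.
rewrite {1}(divn_eq k p); elim: (k %/ p)%N => [//|m ih].
by rewrite mulSn addnAC addnC addnA addnC addnA s_per addnC.
Qed.

Let s_ge0 k : 0 <= s k. Proof. exact: ltW. Qed.
Let c_ge0 k : 0 <= c k. Proof. exact: ltW. Qed.

Let tanh_le j k : s j <= s k -> s j / c j <= s k / c k.
Proof.
move=> jk; rewrite ler_pdivrMr // mulrAC ler_pdivlMr //.
rewrite -ler_sqr ?nnegrE ?mulr_ge0 // !exprMn !cs.
have : s j ^+ 2 <= s k ^+ 2 by rewrite ler_sqr ?nnegrE.
by lra.
Qed.

(** Compare the invariant [F] at a maximum and at a minimum of [s]: with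
    neighbours replaced by the extreme values it bounds [s + s^-1] at the
    maximum by its value at the minimum, while products of neighbours, hence
    of extreme values, exceed 1. *)
Lemma invariant_constant : (forall k, 1 < s k * s k.+1) ->
  (forall k, F k = F k.+1) -> forall k, s k = s 0%N.
Proof.
move=> ss Finv; have FE k : F k = F 0%N by elim: k => // k <-; rewrite -Finv.
pose o := Ordinal p0.
have [m _ hm] := @arg_maxP _ _ 'I_p o xpredT (fun i => s i) isT.
have [z _ hz] := @arg_minP _ _ 'I_p o xpredT (fun i => s i) isT.
have smax k : s k <= s m.
  rewrite (periodic_modn k). exact: (hm (Ordinal (ltn_pmod k p0)) isT).
have smin k : s z <= s k.
  by rewrite (periodic_modn k); exact: (hz (Ordinal (ltn_pmod k p0)) isT).
have shift (i : nat) : s (i + p.-1).+1 = s i by rewrite -addnS prednK.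
have Fm : s z / c z * s m * (s z / c z) <= F 0%N.
  rewrite -(FE (m + p.-1)%N) /F shift.
  apply: ler_pM; rewrite ?mulr_ge0 ?invr_ge0 ?tanh_le //.
  by rewrite ler_pM2r // tanh_le.
have Fz : F 0%N <= s m / c m * s z * (s m / c m).
  rewrite -(FE (z + p.-1)%N) /F shift.
  apply: ler_pM; rewrite ?mulr_ge0 ?invr_ge0 ?tanh_le //.
  by rewrite ler_pM2r // tanh_le.
have sz1 : 1 < s z * s m.
  by apply: lt_le_trans (ss z) _; rewrite ler_pM2l.
have : s z * (1 + s m ^+ 2) <= s m * (1 + s z ^+ 2).
  have := le_trans Fm Fz; rewrite -!cs.
  have -> : s z / c z * s m * (s z / c z) = s z * s m * s z / c z ^+ 2.
    by field; exact: lt0r_neq0.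
  have -> : s m / c m * s z * (s m / c m) = s z * s m * s m / c m ^+ 2.
    by field; exact: lt0r_neq0.
  rewrite ler_pdivrMr ?exprn_gt0 // [leRHS]mulrAC ler_pdivlMr ?exprn_gt0 //.
  rewrite -!mulrA.
  by rewrite ler_pM2l // ler_pM2l.
move=> h; have mz : s m <= s z.
  have : (s m - s z) * (s z * s m - 1) <= 0 by lra.
  by rewrite pmulr_lle0; lra.
move=> k; apply/eqP; rewrite eq_le.
by rewrite !(le_trans (smax _) (le_trans mz (smin _))).
Qed.

End MaximumPrinciple.

Lemma orthonormal_complement (R : realType) (y a b c z : 'rV[R]_4) :
  lorentz y y < 0 -> lorentz a a = 1 -> lorentz b b = 1 -> lorentz c c = 1 ->
  lorentz a b = 0 -> lorentz a c = 0 -> lorentz b c = 0 ->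
  lorentz y a = 0 -> lorentz y b = 0 -> lorentz y c = 0 ->
  lorentz y z = 0 -> lorentz a z = 0 -> lorentz b z = 0 -> lorentz c z = 0 ->
  z = 0.
Proof.
move=> yy aa bb cc ab ac bc ya yb yc yz az bz cz.
pose r (i : 'I_5) := nth 0 [:: z; y; a; b; c] i.
have [|i ri] := @no_orthogonal_family R 3 r.
  by move=> [[|[|[|[|[|i]]]]] Hi] [[|[|[|[|[|j]]]]] Hj] //= _;
    rewrite /r //= 1?lorentzC.
apply: (timelike_perp_eq0 yy yz).
case: i ri => [[|[|[|[|[|i]]]]] Hi] //=; rewrite /r /= => h.
- by rewrite h.
- by rewrite h ltxx in yy.
- by move: aa; rewrite h => /esym/eqP; rewrite oner_eq0.
- by move: bb; rewrite h => /esym/eqP; rewrite oner_eq0.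
- by move: cc; rewrite h => /esym/eqP; rewrite oner_eq0.
Qed.

Lemma vertex_unique (R : realType) (x y y' a b c : 'rV[R]_4) : hspace x ->
  lorentz a a = 1 -> lorentz b b = 1 -> lorentz c c = 1 ->
  lorentz a b = 0 -> lorentz a c = 0 -> lorentz b c = 0 ->
  lorentz y y = -1 -> lorentz x y < 0 ->
  lorentz y a = 0 -> lorentz y b = 0 -> lorentz y c = 0 ->
  lorentz y' y' = -1 -> lorentz x y' < 0 ->
  lorentz y' a = 0 -> lorentz y' b = 0 -> lorentz y' c = 0 ->
  y = y'.
Proof.
move=> xH aa bb cc ab ac bc yy xy ya yb yc yy' xy' ya' yb' yc'.
have yy0 : lorentz y y < 0 by rewrite yy ltrN10.
pose k := - lorentz y y'.
have /eqP : y' - k *: y = 0.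
  apply: (@orthonormal_complement _ y a b c); rewrite ?lorentzE //.
  - by rewrite yy /k; ring.
  - by rewrite !(lorentzC a) ya ya'; ring.
  - by rewrite !(lorentzC b) yb yb'; ring.
  - by rewrite !(lorentzC c) yc yc'; ring.
rewrite subr_eq0 => /eqP yE.
have k2 : k ^+ 2 = 1.
  by move: yy'; rewrite yE !lorentzE yy => h; lra.
have k0 : 0 < k.
  by move: xy'; rewrite yE lorentzE => h; nra.
have kE : k = 1 by apply/eqP; rewrite -(@eqrXn2 _ 2) ?k2 ?expr1n // ltW.
by rewrite yE kE scale1r.
Qed.

Section Band.
Variables (R : realType) (W P : nat -> 'rV[R]_4) (p : nat) (x0 : 'rV[R]_4).
Hypotheses (p0 : (0 < p)%N) (W_per : forall k, W (k + p)%N = W k).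
Hypotheses (x0H : hspace x0) (x0W : forall k, lorentz x0 (W k) < 0).
Hypothesis W0 : forall k, lorentz (W k) (W k) = 1.
Hypothesis W1 : forall k, lorentz (W k) (W k.+1) = 0.
Hypothesis W2 : forall k, lorentz (W k) (W k.+2) = 0.
Hypothesis W3 : forall k, lorentz (W k) (W k.+3) < -1.
Hypothesis W4 : forall k, lorentz (W k) (W k.+4) < -1.
Hypothesis P0 : forall k, lorentz (P k) (P k) = 1.
Hypothesis P_per : forall k, P k.+2 = P k.
Hypothesis PW0 : forall k, lorentz (P k) (W k) < 0.
Hypothesis PW1 : forall k, lorentz (P k) (W k.+1) = 0.
Hypothesis PW1' : forall k, lorentz (P k.+1) (W k) = 0.

Definition band_cosh k := - lorentz (W k) (W k.+3).
Definition band_sinh k := Num.sqrt (band_cosh k ^+ 2 - 1).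
Local Notation c := band_cosh.
Local Notation s := band_sinh.

Lemma band_cosh_gt1 k : 1 < c k.
Proof. by rewrite ltrNr. Qed.

Lemma band_cosh_gt0 k : 0 < c k.
Proof. exact: lt_trans ltr01 (band_cosh_gt1 k). Qed.

Lemma band_sinh_gt0 k : 0 < s k.
Proof. by rewrite sqrtr_gt0; have := band_cosh_gt1 k; nra. Qed.

Lemma band_cosh_sinh k : c k ^+ 2 = 1 + s k ^+ 2.
Proof. by rewrite sqr_sqrtr; [ring|have := band_cosh_gt1 k; nra]. Qed.

(** The vertex common to the facets [k + 1], [k + 2] and [k + 3]. *)
Definition apex k := (s k)^-1 *: (W k + c k *: W k.+3).

(** The same vertex in terms of the facets [k + 1] and [k + 4]: along the edge
    between the facets [k + 2] and [k + 3], the facet [k + 1] is met at this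
    vertex and the facet [k + 4] at the other end. *)
Lemma apexE k : apex k = (s k.+1)^-1 *: (W k.+4 + c k.+1 *: W k.+1).
Proof.
have cs := band_cosh_sinh; have s0 := band_sinh_gt0; have c0 := band_cosh_gt0.
have s2 j : (s j)^-1 ^+ 2 * s j ^+ 2 = 1.
  by rewrite -exprMn mulVf ?expr1n // gt_eqF.
have si j : 0 < (s j)^-1 by rewrite invr_gt0.
have W1' j : lorentz (W j.+1) (W j) = 0 by rewrite lorentzC.
have W2' j : lorentz (W j.+2) (W j) = 0 by rewrite lorentzC.
have W3' j : lorentz (W j) (W j.+3) = - c j by rewrite opprK.
have W3'' j : lorentz (W j.+3) (W j) = - c j by rewrite lorentzC opprK.
have norm j x y : lorentz x x = 1 -> lorentz y y = 1 -> lorentz x y = - c j ->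
    lorentz ((s j)^-1 *: (x + c j *: y)) ((s j)^-1 *: (x + c j *: y)) = -1.
  move=> xx yy xy; rewrite !lorentzE xx yy (lorentzC y) xy.
  transitivity (- ((s j)^-1 ^+ 2 * (c j ^+ 2 - 1))); first by ring.
  by rewrite cs addrC addKr s2.
have neg j x y : lorentz x0 x < 0 -> lorentz x0 y < 0 ->
    lorentz x0 ((s j)^-1 *: (x + c j *: y)) < 0.
  move=> xx xy; rewrite !lorentzE pmulr_rlt0 //.
  by have := c0 j; nra.
apply: (@vertex_unique _ x0 _ _ (W k.+1) (W k.+2) (W k.+3)) => //.
- by apply: norm.
- by apply: neg.
- by rewrite !lorentzE W1 W2'; ring.
- by rewrite !lorentzE W2 W1'; ring.
- by rewrite !lorentzE W3' W0; ring.
- by apply: norm.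
- by apply: neg.
- by rewrite !lorentzE W3'' W0; ring.
- by rewrite !lorentzE W2' W1; ring.
- by rewrite !lorentzE W1' W2; ring.
Qed.

Lemma band_step4 k : lorentz (W k) (W k.+4) = - (s k * s k.+1).
Proof.
have s0 := gt_eqF (band_sinh_gt0 k); have s1 := gt_eqF (band_sinh_gt0 k.+1).
have := congr1 (fun y => lorentz y (W k)) (apexE k).
rewrite /apex !lorentzE W0 (lorentzC (W k.+3)) (lorentzC (W k.+4)).
rewrite (lorentzC (W k.+1)) W1 mulr0 addr0.
have -> : lorentz (W k) (W k.+3) = - c k by rewrite opprK.
have -> : 1 + c k * - c k = - s k ^+ 2 by have := band_cosh_sinh k; lra.
move=> h; apply: (mulfI (x := (s k.+1)^-1)); first by rewrite invr_eq0 s1.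
rewrite -h; field; by rewrite s0 s1.
Qed.

Let f k := - lorentz (P k) (W k).

Let f_gt0 k : 0 < f k. Proof. by rewrite oppr_gt0. Qed.

Let f_shift2 k : lorentz (P k) (W k.+2) = - f k.+2.
Proof. by rewrite opprK P_per. Qed.

Let f_ratio k : c k * s k.+1 * f k.+3 = c k.+1 * s k * f k.+1.
Proof.
have s0 := gt_eqF (band_sinh_gt0 k); have s1 := gt_eqF (band_sinh_gt0 k.+1).
have := congr1 (lorentz (P k.+1)) (apexE k).
rewrite /apex !lorentzE PW1' f_shift2 -[lorentz (P k.+1) (W k.+1)]opprK -/(f k.+1).
have -> : lorentz (P k.+1) (W k.+4) = 0 by rewrite -P_per PW1.
move=> h.
have : s k * s k.+1 * ((s k)^-1 * (0 + c k * - f k.+3)) =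
  s k * s k.+1 * ((s k.+1)^-1 * (0 + c k.+1 * - f k.+1)) by rewrite h.
have -> : s k * s k.+1 * ((s k)^-1 * (0 + c k * - f k.+3)) = - (c k * s k.+1 * f k.+3).
  by field; rewrite s0.
have -> : s k * s k.+1 * ((s k.+1)^-1 * (0 + c k.+1 * - f k.+1)) = - (c k.+1 * s k * f k.+1).
  by field; rewrite s1.
exact: oppr_inj.
Qed.

Let f_ratio4 k : s k.+1 * f k = s k * f k.+4.
Proof.
have s0 := gt_eqF (band_sinh_gt0 k); have s1 := gt_eqF (band_sinh_gt0 k.+1).
have := congr1 (lorentz (P k)) (apexE k).
rewrite /apex !lorentzE PW1 -[lorentz (P k) (W k)]opprK -/(f k).
have -> : lorentz (P k) (W k.+3) = 0 by rewrite -P_per PW1.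
have -> : lorentz (P k) (W k.+4) = - f k.+4 by rewrite -(P_per k) -(P_per k.+2) opprK.
move=> h.
have : s k * s k.+1 * ((s k)^-1 * (- f k + c k * 0)) =
  s k * s k.+1 * ((s k.+1)^-1 * (- f k.+4 + c k.+1 * 0)) by rewrite h.
have -> : s k * s k.+1 * ((s k)^-1 * (- f k + c k * 0)) = - (s k.+1 * f k).
  by field; rewrite s0.
have -> : s k * s k.+1 * ((s k.+1)^-1 * (- f k.+4 + c k.+1 * 0)) = - (s k * f k.+4).
  by field; rewrite s1.
exact: oppr_inj.
Qed.

(** Comparing the distances to the top and bottom planes across consecutive
    vertices shows that the quantity of [invariant_constant] does not change
    along the band. *)
Lemma band_rigid k : s k = s 0%N.
Proof.
have cs := band_cosh_sinh; have s0 := band_sinh_gt0; have c0 := band_cosh_gt0.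
move: k; apply: (@invariant_constant R s c p) => // k.
- by rewrite /band_sinh /band_cosh -!addSn !W_per.
- by have := W4 k; rewrite band_step4 ltrN2.
have r1 := f_ratio k; have r2 := f_ratio4 k.+1; have r3 := f_ratio k.+2.
have key : s k * c k.+1 * c k.+3 = s k.+3 * c k * c k.+2.
  have nz : s k.+1 * s k.+2 * f k.+1 * f k.+3 != 0.
    by rewrite !mulf_neq0 // gt_eqF.
  apply: (mulfI nz).
  transitivity ((c k.+1 * s k * f k.+1) * (c k.+3 * s k.+2 * f k.+3) * s k.+1).
    by ring.
  rewrite -r1 -r3.
  transitivity ((s k.+1 * f k.+4.+1) * (c k * s k.+1 * f k.+3 * c k.+2 * s k.+3)).
    by ring.
  by rewrite -r2; ring.
have [n0 n1 n2 n3] : [/\ c k != 0, c k.+1 != 0, c k.+2 != 0 & c k.+3 != 0].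
  by split; rewrite gt_eqF.
rewrite (_ : s k / c k * s k.+1 * (s k.+2 / c k.+2) =
  s k * c k.+1 * c k.+3 * (s k.+1 * s k.+2) / (c k * c k.+1 * c k.+2 * c k.+3)).
  by rewrite key; field; rewrite n0 n1 n2 n3.
by field; rewrite n0 n1 n2 n3.
Qed.

Let cc := c 0%N.
Let ss := s 0%N.

Lemma band_cosh_const k : c k = c 0%N.
Proof.
apply/eqP; rewrite -(@eqrXn2 _ 2) ?(ltW (band_cosh_gt0 _)) //.
by rewrite !band_cosh_sinh band_rigid.
Qed.

Lemma band_sinh2 : ss ^+ 2 = cc ^+ 2 - 1.
Proof. by rewrite /cc band_cosh_sinh addrC addKr. Qed.

Lemma band_cosh2_gt2 : 2 < cc ^+ 2.
Proof.
have := W4 0%N; rewrite band_step4 ltrN2 band_rigid -expr2 band_sinh2; lra.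
Qed.

Lemma band_recurrence k : W k.+4 = W k + cc *: W k.+3 - cc *: W k.+1.
Proof.
have := apexE k; rewrite /apex !band_rigid !band_cosh_const.
have s0 : (s 0%N)^-1 != 0 by rewrite invr_eq0 gt_eqF ?band_sinh_gt0.
by move=> /(scalerI s0) ->; rewrite addrK.
Qed.

(** Chebyshev polynomials of the second kind: if [c] is twice the cosine of an
    angle then [chebyshev c k] is the quotient of the sines of [k] times this
    angle and of the angle. *)
Fixpoint chebyshev_pair (x : R) (k : nat) : R * R :=
  if k is k'.+1 then
    let: (a, b) := chebyshev_pair x k' in (b, x * b - a)
  else (0, 1).
Definition chebyshev x k := (chebyshev_pair x k).1.

Lemma chebyshevSS x k :
  chebyshev x k.+2 = x * chebyshev x k.+1 - chebyshev x k.
Proof. by rewrite /chebyshev /=; case: (chebyshev_pair x k). Qed.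

Local Notation a := (chebyshev cc).

Lemma band_gram k i : lorentz (W k) (W (k + i.*2)) = 1 - a i ^+ 2 /\
  lorentz (W k) (W (k + i.*2).+1) = - (a i * a i.+1).
Proof.
have a0 : a 0 = 0 by []. have a1 : a 1 = 1 by [].
pose D j := lorentz (W k) (W (k + j)%N).
have Drec j : D j.+4 = D j + cc * D j.+3 - cc * D j.+1.
  by rewrite /D !addnS band_recurrence !lorentzE.
suff H i' : D i'.*2 = 1 - a i' ^+ 2 /\ D i'.*2.+1 = - (a i' * a i'.+1) /\
    D i'.*2.+2 = 1 - a i'.+1 ^+ 2 /\ D i'.*2.+3 = - (a i'.+1 * a i'.+2).
  by have [h1 [h2 _]] := H i; rewrite -addnS.
elim: i' => [|j [h0 [h1 [h2 h3]]]].
  rewrite /D !addnS addn0 W0 W1 W2 chebyshevSS a0 a1; do 3![split; first by ring].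
  rewrite -[LHS]opprK -/(c k) band_cosh_const -/cc; ring.
rewrite doubleS; do 2![split => //]; split.
  by rewrite Drec h0 h1 h3 !chebyshevSS; ring.
by rewrite Drec h1 h2 Drec h0 h1 h3 !chebyshevSS; ring.
Qed.

Let f_const2 k : f k.+3 = f k.+1.
Proof.
have := f_ratio k; rewrite !band_rigid !band_cosh_const; apply: mulfI.
by rewrite mulf_neq0 // gt_eqF ?band_cosh_gt0 ?band_sinh_gt0.
Qed.

Let apex_perp k : [/\ lorentz (apex k) (apex k) = -1,
  lorentz (apex k) (W k.+1) = 0, lorentz (apex k) (W k.+2) = 0 &
  lorentz (apex k) (W k.+3) = 0].
Proof.
have s0 := gt_eqF (band_sinh_gt0 k); have cs := band_cosh_sinh k.
have cE : lorentz (W k) (W k.+3) = - c k by rewrite opprK.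
rewrite /apex !lorentzE (lorentzC (W k.+3) (W k)) cE !W0 W1 W2.
rewrite (lorentzC (W k.+3) (W k.+1)) (lorentzC (W k.+3) (W k.+2)) W1 W2.
split; [|by ring..].
transitivity (- ((s k)^-1 ^+ 2 * (c k ^+ 2 - 1))); first by ring.
by rewrite cs; field; rewrite s0.
Qed.

(** The planes of the two caps, expanded in the orthonormal basis formed by a
    vertex of the band and its three facets. *)
Let cap_expansion k : P k.+1 =
  (f k.+1 / ss) *: apex k.+1 - f k.+1 *: W k.+3.
Proof.
have sn0 : ss != 0 by rewrite gt_eqF ?band_sinh_gt0.
have [yy y1 y2 y3] := apex_perp k.+1.
have Pa : lorentz (P k.+1) (apex k.+1) = - (f k.+1 / ss).
  rewrite /apex !lorentzE band_rigid (_ : lorentz _ (W k.+4) = 0).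
    by rewrite /f -/ss; field.
  by rewrite -P_per PW1.
have PW4 : lorentz (P k.+1) (W k.+4) = 0 by rewrite -P_per PW1.
have PW : lorentz (P k.+1) (W k.+3) = - f k.+1 by rewrite f_shift2 f_const2.
move: (apex k.+1) yy y1 y2 y3 Pa => y yy y1 y2 y3 Pa.
apply/eqP; rewrite -subr_eq0; apply/eqP.
apply: (@orthonormal_complement _ y (W k.+2) (W k.+3) (W k.+4)) => //.
- by rewrite yy ltrN10.
- by rewrite !lorentzE (lorentzC _ (P k.+1)) Pa yy y2; ring.
- rewrite !lorentzE !(lorentzC (W k.+2)) PW1 y1 (lorentzC (W k.+3)) W1; ring.
- by rewrite !lorentzE !(lorentzC (W k.+3)) PW y2 W0; ring.
- by rewrite !lorentzE !(lorentzC (W k.+4)) y3 W1 PW4; ring.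
Qed.

Let cap_height k : f k.+1 ^+ 2 * (cc ^+ 2 - 2) = cc ^+ 2 - 1.
Proof.
have sn0 : ss != 0 by rewrite gt_eqF ?band_sinh_gt0.
have := P0 k.+1; rewrite {1}cap_expansion /apex !lorentzE band_rigid.
rewrite !(lorentzC (W _)) f_shift2 f_const2.
rewrite (_ : lorentz (P k.+1) (W k.+4) = 0); last by rewrite -P_per PW1.
rewrite -[lorentz (P k.+1) (W k.+1)]opprK -/(f k.+1) -/ss => h.
have -> : cc ^+ 2 - 2 = ss ^+ 2 - 1 by rewrite band_sinh2; ring.
rewrite -band_sinh2.
have -> : f k.+1 ^+ 2 * (ss ^+ 2 - 1) = ss ^+ 2 * (f k.+1 / ss * (ss^-1 * (- f k.+1 + c k.+1 * 0)) - f k.+1 * - f k.+1).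
  by field.
by rewrite h mulr1.
Qed.

Lemma band_cap_height k :
  lorentz (P k.+1) (W k.+1) ^+ 2 * (cc ^+ 2 - 2) = cc ^+ 2 - 1.
Proof. by have := cap_height k; rewrite /f sqrrN. Qed.

Lemma band_cap_distance k : lorentz (P k.+1) (P k.+2) * (cc ^+ 2 - 2) = - cc.
Proof.
have sn0 : ss != 0 by rewrite gt_eqF ?band_sinh_gt0.
have h1 := cap_height k; have h2 := cap_height k.+1.
have c2 : 0 < cc ^+ 2 - 2 by have := band_cosh2_gt2; lra.
have fE : f k.+2 = f k.+1.
  apply/eqP; rewrite -(@eqrXn2 _ 2) ?ltW //; apply/eqP.
  by apply: (mulIf (lt0r_neq0 c2)); rewrite h1 h2.
rewrite {1}cap_expansion /apex !lorentzE band_rigid band_cosh_const.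
rewrite !(lorentzC (W _)) PW1 PW1' -[lorentz (P k.+2) (W k.+4)]opprK.
rewrite -{1}(P_per k.+2) -/(f k.+4) !f_const2 fE -/ss -/cc.
transitivity (- cc * (f k.+1 ^+ 2 * (cc ^+ 2 - 2)) / ss ^+ 2); first by field.
by rewrite h1 -band_sinh2; field.
Qed.

Variable n : nat.
Hypotheses (pn : p = n.*2) (n9 : (9 <= n)%N).
Hypothesis W_far : forall k j, (3 <= j)%N -> (j + 3 <= p)%N ->
  lorentz (W k) (W (k + j)%N) < -1.

Let a_even i : (2 <= i)%N -> (i + 2 <= n)%N -> 2 < a i ^+ 2.
Proof.
move=> i2 ni; have [h _] := band_gram 0 i.
have := @W_far 0 i.*2; rewrite h => /(_ _ _)/wrap[]; rewrite ?pn; try lia.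
lra.
Qed.

Let a_odd i : (1 <= i)%N -> (i + 2 <= n)%N -> 1 < a i * a i.+1.
Proof.
move=> i1 ni; have [_ h] := band_gram 0 i.
have := @W_far 0 i.*2.+1; rewrite addnS h => /(_ _ _)/wrap[]; rewrite ?pn; try lia.
lra.
Qed.

(** The polynomial [chebyshev c 8] factors as
    [c * (c ^ 2 - 2) * ((c ^ 2 - 2) ^ 2 - 2)]. It is positive because facets an
    odd number of steps apart, at most fifteen, are disjoint; for fifteen
    steps not to lead back to a neighbour takes [9 <= n]. *)
Lemma band_cosh_bound : 2 < (cc ^+ 2 - 2) ^+ 2.
Proof.
have c2 := band_cosh2_gt2; have c0 : 0 < cc := band_cosh_gt0 0.
have apos i : (i < 8)%N -> 0 < a i.+1.
  elim: i => [|i ih] i8; first exact: ltr01.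
  have h1 := ih (ltnW i8); have := @a_odd i.+1 isT.
  have -> : (i.+1 + 2 <= n)%N by lia.
  move=> /(_ isT) h2; rewrite -(pmulr_rgt0 _ h1); exact: lt_trans h2.
have := apos 7 isT.
have -> : a 8 = cc * (cc ^+ 2 - 2) * ((cc ^+ 2 - 2) ^+ 2 - 2).
  rewrite !chebyshevSS (_ : a 1 = 1) // (_ : a 0 = 0) //; ring.
rewrite pmulr_rgt0 ?subr_gt0 // mulr_gt0 // subr_gt0 //.
Qed.

Let C := cc / (cc ^+ 2 - 2).

Let cosh2_gt3 : 3 < cc ^+ 2.
Proof. by have := band_cosh2_gt2; have := band_cosh_bound; nra. Qed.

Let C_le_cosh : C <= cc.
Proof.
have c3 := cosh2_gt3; have c0 : 0 < cc := band_cosh_gt0 0.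
rewrite /C ler_pdivrMr ?ler_peMr ?ltW //; lra.
Qed.

Let C_le_cosh2 : C <= cc ^+ 2 - 1.
Proof.
have c3 := cosh2_gt3; have c0 : 0 < cc := band_cosh_gt0 0.
have c1 : 17 / 10 < cc by nra.
by apply: le_trans C_le_cosh _; nra.
Qed.

Let C_le2 : C <= 2.
Proof.
have c3 := cosh2_gt3; have c0 : 0 < cc := band_cosh_gt0 0.
by rewrite /C ler_pdivrMr; [rewrite -ler_sqr ?nnegrE; nra|lra].
Qed.

Let chebyshev_cassini i : a i.+2 * a i = a i.+1 ^+ 2 - 1.
Proof.
elim: i => [|i ih]; first by rewrite /chebyshev /= mulr0 expr1n subrr.
have e : a i = cc * a i.+1 - a i.+2 by rewrite chebyshevSS; ring.
rewrite e in ih; rewrite (chebyshevSS _ i.+1); lra.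
Qed.

(** The nearest disjoint pairs are those three or four steps apart, in either
    direction around the band. For all others the square of the product is that
    of a product of two Chebyshev values whose squares exceed [2], by
    [chebyshev_cassini] when the number of steps is even. *)
Lemma band_far_le k j : (3 <= j)%N -> (j + 3 <= p)%N ->
  lorentz (W k) (W (k + j)%N) <= - C.
Proof.
move=> j3 jp.
have step3 m : lorentz (W m) (W (m + 3)) <= - C.
  have [_] := band_gram m 1; rewrite -addnS => ->; rewrite lerN2.
  by rewrite (_ : a 1 = 1) // mul1r (_ : a 2 = cc) // /chebyshev /= mulr1 subr0.
have step4 m : lorentz (W m) (W (m + 4)) <= - C.
  have [-> _] := band_gram m 2; have := C_le_cosh2.
  by rewrite (_ : a 2 = cc) /chebyshev /= ?mulr1 ?subr0 //; lra.
have wrap m : (m + j = p)%N -> lorentz (W k) (W (k + j)) = lorentz (W (k + j)) (W (k + j + m)).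
  by move=> mj; rewrite -addnA (addnC j) mj W_per lorentzC.
have le2 x : 2 < x -> - x <= - C by move=> x2; rewrite lerN2; have := C_le2; lra.
have jE := odd_double_half j; move: jE; set i := j./2.
case: (odd j) => /= [|]; rewrite ?add1n ?add0n => jE.
  have [i1|i1] := leqP i 1; first by rewrite (_ : j = 3) //; lia.
  have [i2|i2] := leqP n (i + 2).
    by rewrite (wrap 3) //; lia.
  rewrite -jE addnS; have [_ ->] := band_gram k i; apply: le2.
  have h1 : 2 < a i ^+ 2 by apply: a_even; lia.
  have h2 : 2 < a i.+1 ^+ 2 by apply: a_even; lia.
  have h3 : 1 < a i * a i.+1 by apply: a_odd; lia.
  rewrite -ltr_sqr ?nnegrE // ?exprMn; [nra|lra].
have [i1|i1] := leqP i 2; first by rewrite (_ : j = 4) //; lia.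
have [i2|i2] := leqP n (i + 2).
  by rewrite (wrap 4) //; lia.
rewrite -jE; have [-> _] := band_gram k i; rewrite -opprB; apply: le2.
have [m mi] : exists m, i = m.+1 by exists i.-1; lia.
have h1 : 2 < a m ^+ 2 by apply: a_even; lia.
have h2 : 2 < a m.+2 ^+ 2 by apply: a_even; lia.
have h3 : 2 < a i ^+ 2 by apply: a_even; lia.
rewrite -ltr_sqr ?nnegrE //; last by lra.
rewrite mi -chebyshev_cassini exprMn; nra.
Qed.

(** In terms of [c] this inequality is the one of [band_cosh_bound]. *)
Lemma band_cap_le k : lorentz (P k.+1) (W k.+1) <= - C.
Proof.
have c3 := cosh2_gt3; have cb := band_cosh_bound; have c0 : 0 < cc := band_cosh_gt0 0.
have c2 : 0 < cc ^+ 2 - 2 by lra.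
have h := band_cap_height k; have := PW0 k.+1.
move: (lorentz _ _) h => x h x0'; rewrite lerNr /C ler_pdivrMr //.
rewrite -ler_sqr ?nnegrE ?(ltW c0) ?mulr_ge0 ?oppr_ge0 ?(ltW x0') ?(ltW c2) //.
have -> : (- x * (cc ^+ 2 - 2)) ^+ 2 = (x ^+ 2 * (cc ^+ 2 - 2)) * (cc ^+ 2 - 2) by ring.
by rewrite h; move: cb; rewrite !expr2; lra.
Qed.

End Band.

(** * Disjoint facets at minimal distance *)

Section CommonPerpendicular.
Variables (R : realType) (I : finType) (e : I -> 'rV[R]_4).
Hypothesis cpt : compact_polyhedron e.
Hypothesis right_angled :
  forall a b, Defs.adjacent e a b -> lorentz (e a) (e b) = 0.
Variables a b : I.
Hypotheses (ab : a <> b) (nadj : ~ Defs.adjacent e a b).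

Let C := - lorentz (e a) (e b).
Let C1 : 1 < C.
Proof. by rewrite ltrNr; exact: wall_separation. Qed.
Let delta := arcosh C.
Let S := sinh delta.
Let coshE : cosh delta = C.
Proof. by rewrite cosh_arcosh // ltW. Qed.
Let S0 : 0 < S.
Proof. by rewrite sinh_gt0 // arcosh_gt0. Qed.
Let S2 : S ^+ 2 = C ^+ 2 - 1.
Proof. by rewrite -coshE; have := cosh_sinh delta; rewrite -/S; lra. Qed.

(** The feet of the common perpendicular are combinations with nonnegative
    coefficients of the two normals, so nonpositivity of the Gram matrix puts
    them in the polyhedron. *)
Lemma foot_in_face (c d : I) : c <> d -> lorentz (e c) (e d) = - C ->
  face e c (S^-1 *: (e d + C *: e c)).
Proof.
move=> cd cdC; set y := S^-1 *: _.
have ec := unit_normal cpt c; have ed := unit_normal cpt d.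
have yc : lorentz y (e c) = 0.
  by rewrite /y !lorentzE (lorentzC (e d)) ec cdC; ring.
have yy : lorentz y y = -1.
  rewrite /y !lorentzE (lorentzC (e d)) ec ed cdC.
  transitivity (- (S^-1 ^+ 2 * (C ^+ 2 - 1))); first by ring.
  by rewrite -S2; field; exact: lt0r_neq0.
have [x xH xlt] := interior_point cpt.
have Si : 0 < S^-1 by rewrite invr_gt0.
have hC := C1.
have xy : lorentz x y < 0.
  by rewrite /y !lorentzE pmulr_rlt0 //; have := xlt c; have := xlt d; nra.
have yn0 : y != 0.
  by apply: contra_eq_neq yy => ->; rewrite lorentz0l eq_sym oppr_eq0 oner_neq0.
split=> //; split.
  by split=> //; rewrite -(hspace_neg xH) // yy lerN10.
move=> m; have [->|/eqP mc] := eqVneq m c; first by rewrite yc.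
rewrite /y !lorentzE pmulr_rle0 //.
have [->|/eqP md] := eqVneq m d; first by rewrite ed cdC; nra.
have := gram_le0 cpt right_angled (nesym mc).
have := gram_le0 cpt right_angled (nesym md); nra.
Qed.

Let p := S^-1 *: (e b + C *: e a).
Let q := S^-1 *: (e a + C *: e b).
Let abC : lorentz (e a) (e b) = - C. Proof. by rewrite opprK. Qed.
Let baC : lorentz (e b) (e a) = - C. Proof. by rewrite lorentzC. Qed.

Let pq : lorentz p q = - C.
Proof.
rewrite /p /q !lorentzE baC abC !(unit_normal cpt).
transitivity (- (C * (S^-1 ^+ 2 * (C ^+ 2 - 1)))); first by ring.
by rewrite -S2; field; exact: lt0r_neq0.
Qed.

Lemma set_dist_faces : set_dist (face e a) (face e b) = delta.
Proof.
have pF : face e a p by exact: foot_in_face.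
have qF : face e b q by apply: foot_in_face => //; exact: nesym.
have dS : [set hdist z.1 z.2 | z in face e a `*` face e b] delta.
  by exists (p, q) => //=; rewrite /hdist pq opprK.
have lb : lbound [set hdist z.1 z.2 | z in face e a `*` face e b] delta.
  move=> _ [[x y] /= [[[xH _] xa] [[yH _] yb]] <-].
  apply: le_arcosh; first exact: (ltW C1).
  apply: (wall_distance xH yH (unit_normal cpt a) (unit_normal cpt b)) => //.
    exact: (ltW C1).
  by rewrite sqrrN.
apply/eqP; rewrite eq_le; apply/andP; split.
  by apply: ge_inf => //; exists delta.
by apply: lb_le_inf => //; exists delta.
Qed.

(** Each of the two reflections reverses the common perpendicular about its
    foot, and the feet are at distance [delta]. *)
Lemma loxodromic_reflections :
  loxodromic (reflection (e a) \o reflection (e b)) (2 * delta).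
Proof.
have d0 : 0 < delta by rewrite arcosh_gt0.
split; first by rewrite mulr_gt0.
have ea := unit_normal cpt a; have eb := unit_normal cpt b.
have [z zH [zb za zE]] : exists2 z, hspace z & [/\ lorentz z (e b) = 0,
    lorentz z (e a) = - S & e a = S *: z - C *: e b].
  have [[qH _] qb] : face e b q by apply: foot_in_face => //; exact: nesym.
  exists q => //; split=> //; rewrite /q.
    rewrite !lorentzE ea baC.
    transitivity (- (S^-1 * (C ^+ 2 - 1))); first by ring.
    by rewrite -S2; field; exact: lt0r_neq0.
  by rewrite scalerA mulfV ?gt_eqF // scale1r addrK.
exists (fun t => cosh t *: z - sinh t *: e b); first exact: geodesic_through.
move=> t.
have refb : reflection (e b) (cosh t *: z - sinh t *: e b) =
    cosh t *: z + sinh t *: e b.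
  rewrite /reflection !lorentzE zb eb.
  by apply/rowP => i; rewrite !mxE; ring.
rewrite /= refb /reflection !lorentzE za baC zE.
have hS : sinh delta = S by [].
have CS : C ^+ 2 = 1 + S ^+ 2 by rewrite S2; ring.
have c2 : cosh (2 * delta) = 2 * C ^+ 2 - 1 by rewrite cosh_double coshE.
have s2 : sinh (2 * delta) = 2 * S * C.
  by rewrite mulr_natl mulr2n sinhD coshE hS; ring.
have -> : cosh (t + 2 * delta) = cosh t - 2 * (cosh t * - S + sinh t * - C) * S.
  by rewrite coshD c2 s2 CS; ring.
have -> : sinh (t + 2 * delta) =
    - (sinh t + 2 * (cosh t * - S + sinh t * - C) * C).
  by rewrite sinhD c2 s2; ring.
apply/rowP => i; rewrite !mxE; ring.
Qed.

End CommonPerpendicular.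

(** * The Löbell polyhedron *)

Section LobellFaces.
Variable n : nat.

Definition lobell_face_code (a : lobell_face n) : option (option ('I_n + 'I_n)) :=
  match a with
  | Top => None
  | Bottom => Some None
  | Upper i => Some (Some (inl i))
  | Lower i => Some (Some (inr i))
  end.

Definition lobell_face_decode (c : option (option ('I_n + 'I_n))) :
    lobell_face n :=
  match c with
  | None => Top
  | Some None => Bottom
  | Some (Some (inl i)) => Upper i
  | Some (Some (inr i)) => Lower i
  end.

Lemma lobell_face_codeK : cancel lobell_face_code lobell_face_decode.
Proof. by case. Qed.

HB.instance Definition _ :=
  Finite.copy (lobell_face n) (can_type lobell_face_codeK).

Lemma lobell_adjC (a b : lobell_face n) : lobell_adj a b = lobell_adj b a.
Proof. by case: a b => [||i|i] [||j|j] //=; rewrite orbC. Qed.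

Hypothesis n_gt0 : (0 < n)%N.

Definition idx k : 'I_n := Ordinal (ltn_pmod k n_gt0).

Lemma ordS_idx k : ordS (idx k) = idx k.+1.
Proof. by apply: val_inj; rewrite /= -addn1 modnDml addn1. Qed.

Lemma idxDn k : idx (k + n) = idx k.
Proof. by apply: val_inj; rewrite /= modnDr. Qed.

Lemma idx_ord (i : 'I_n) : idx i = i.
Proof. by apply: val_inj; rewrite /= modn_small. Qed.

Lemma idx_neq k m : (0 < m < n)%N -> (idx k == idx (k + m)) = false.
Proof.
move=> /andP[m0 mn]; apply/eqP => /(congr1 val) /= /eqP.
rewrite -{1}(addn0 k) eqn_modDl mod0n modn_small // => /eqP m0'.
by rewrite -m0' in m0.
Qed.

(** In this cyclic order of the lateral facets the adjacent ones are exactly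
    those at most two steps apart. *)
Definition lateral k : lobell_face n :=
  if odd k then Upper (idx k./2) else Lower (idx k./2).

Definition cap k : lobell_face n := if odd k then Bottom else Top.

Lemma lateral_even i : lateral i.*2 = Lower (idx i).
Proof. by rewrite /lateral odd_double doubleK. Qed.

Lemma lateral_odd i : lateral i.*2.+1 = Upper (idx i).
Proof. by rewrite /lateral /= odd_double /= uphalf_double. Qed.

Lemma lateral_per k : lateral (k + n.*2) = lateral k.
Proof.
by rewrite /lateral oddD odd_double addbF halfD odd_double andbF doubleK add0n idxDn.
Qed.

Variant parity_spec k : Type :=
| EvenSpec i of k = i.*2 | OddSpec i of k = i.*2.+1.

Lemma parityP k : parity_spec k.
Proof.
have := odd_double_half k; case: (odd k) => /= <-.
  by apply: (@OddSpec _ k./2); rewrite add1n.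
by apply: (@EvenSpec _ k./2); rewrite add0n.
Qed.

Lemma lateral_adj1 k : lobell_adj (lateral k) (lateral k.+1).
Proof.
case: (parityP k) => i ->; rewrite -?doubleS ?lateral_even ?lateral_odd /=.
  by rewrite eqxx.
by rewrite ordS_idx eqxx orbT.
Qed.

Lemma lateral_adj2 k : lobell_adj (lateral k) (lateral k.+2).
Proof.
by case: (parityP k) => i ->; rewrite -doubleS ?lateral_even ?lateral_odd /=
  ordS_idx eqxx.
Qed.

Lemma lateral_far k j : (3 <= j)%N -> (j + 3 <= n.*2)%N ->
  lateral k <> lateral (k + j) /\ lobell_adj (lateral k) (lateral (k + j)) = false.
Proof.
move=> j3 jn.
have neq x m : (0 < m < n)%N -> idx x <> idx (x + m).
  by move=> h; apply/eqP; rewrite idx_neq.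
have far1 x m : (0 < m.+1 < n)%N -> (idx x == idx (x + m).+1) = false.
  by rewrite -addnS; exact: idx_neq.
have far2 x m : (1 < m < n)%N -> (idx (x + m) == idx x.+1) = false.
  move=> h; rewrite eq_sym (_ : x + m = x.+1 + m.-1)%N; last by lia.
  by apply: idx_neq; lia.
have Ui (x y : 'I_n) : Upper x = Upper y -> x = y by case.
have Li (x y : 'I_n) : Lower x = Lower y -> x = y by case.
case: (parityP k) => i ->; case: (parityP j) => m jE; rewrite jE in j3 jn *.
- rewrite -doubleD !lateral_even /=; split; first by move/Li; apply: neq; lia.
  by rewrite !ordS_idx far1 ?far2 //; lia.
- rewrite addnS -doubleD lateral_even lateral_odd /=; split=> //.
  rewrite ordS_idx -addnS !idx_neq //; lia.
- rewrite addSn -doubleD !lateral_odd /=; split; first by move/Ui; apply: neq; lia.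
  by rewrite !ordS_idx far1 ?far2 //; lia.
- rewrite addSn addnS -doubleD -doubleS lateral_odd lateral_even /=; split=> //.
  rewrite ordS_idx !(eq_sym (idx (i + m).+1)) -addnS idx_neq ?orFb; last by lia.
  by rewrite addnS -addSn idx_neq //; lia.
Qed.

Lemma lateralP (a : lobell_face n) :
  [\/ a = Top, a = Bottom | exists2 k, (k < n.*2)%N & a = lateral k].
Proof.
case: a => [||i|i]; [by constructor 1|by constructor 2|constructor 3..].
  by exists i.*2.+1; rewrite ?lateral_odd ?idx_ord //; have := ltn_ord i; lia.
by exists i.*2; rewrite ?lateral_even ?idx_ord //; have := ltn_ord i; lia.
Qed.

Lemma lateral_nonadj j k : (j < n.*2)%N -> (k < n.*2)%N -> j != k ->
  lobell_adj (lateral j) (lateral k) = false ->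
  exists x, exists d, [/\ (3 <= d)%N, (d + 3 <= n.*2)%N &
    (lateral j = lateral x /\ lateral k = lateral (x + d)) \/
    (lateral k = lateral x /\ lateral j = lateral (x + d))].
Proof.
wlog jk : j k / (j < k)%N => [hw|] jn kn jNk nadj.
  case: (ltngtP j k) (jNk) => // [jk _|kj _]; first exact: hw.
  have nadj' : lobell_adj (lateral k) (lateral j) = false by rewrite lobell_adjC.
  rewrite eq_sym in jNk.
  have [x [d [d3 dn h]]] := hw k j kj kn jn jNk nadj'.
  by exists x, d; split=> //; case: h; [right|left].
exists j, (k - j)%N; split; [| |by left; rewrite subnKC // ltnW].
- rewrite leqNgt; apply/negP => h.
  have [e|e] : (k = j.+1 \/ k = j.+2)%N by lia.
    by rewrite e lateral_adj1 in nadj.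
  by rewrite e lateral_adj2 in nadj.
- rewrite leqNgt; apply/negP => h; rewrite lobell_adjC -(lateral_per j) in nadj.
  have [e|e] : (j + n.*2 = k.+1 \/ j + n.*2 = k.+2)%N by lia.
    by rewrite e lateral_adj1 in nadj.
  by rewrite e lateral_adj2 in nadj.
Qed.

End LobellFaces.

Section Lobell.
Variables (R : realType) (n : nat) (e : lobell_face n -> 'rV[R]_4).
Hypotheses (n9 : (9 <= n)%N) (He : lobell_polyhedron e).

Let n_gt0 : (0 < n)%N. Proof. exact: leq_trans n9. Qed.

Let cpt : compact_polyhedron e. Proof. by have [] := He. Qed.

Let adjE a b : Defs.adjacent e a b <-> lobell_adj a b.
Proof. by have [_ h _] := He; exact: h. Qed.

(** A common point of the two facets is a timelike vector orthogonal to both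
    normals, so their product is in the domain where [acos] can be inverted. *)
Lemma lobell_right_angled a b :
  Defs.adjacent e a b -> lorentz (e a) (e b) = 0.
Proof.
move=> adj; have [_ _ /(_ _ _ adj)] := He; rewrite /dihedral_angle => angle.
have [_ [x [_ [_ [[[xH _] xa] [_ xb]] _]]]] := adj.
have ea := unit_normal cpt a; have eb := unit_normal cpt b.
have [xx _] := xH; have x_lt0 : lorentz x x < 0 by rewrite xx ltrN10.
have := @timelike_perp_ge0 _ _ x (e a + e b) x_lt0.
have := @timelike_perp_ge0 _ _ x (e a - e b) x_lt0.
rewrite !lorentzE xa xb subr0 addr0 ea eb (lorentzC (e b)).
move=> /(_ erefl) h1 /(_ erefl) h2.
have : cos (acos (- lorentz (e a) (e b))) = - lorentz (e a) (e b).
  by apply: acosK; rewrite in_itv /=; lra.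
rewrite angle cos_pihalf; lra.
Qed.

Let W k := e (lateral n_gt0 k).
Let P k := e (cap n k).

Let orth a b : lobell_adj a b -> lorentz (e a) (e b) = 0.
Proof. by move/adjE; exact: lobell_right_angled. Qed.

Let far a b : a <> b -> lobell_adj a b = false -> lorentz (e a) (e b) < -1.
Proof.
move=> ab nadj; apply: (wall_separation cpt lobell_right_angled) => //.
by rewrite adjE nadj.
Qed.

Let C := - lorentz (e Top) (e Bottom).

Let C1 : 1 < C.
Proof. by rewrite ltrNr; exact: far. Qed.

(** The top and bottom facets are the closest among the disjoint ones: the
    computations for the band apply to [lateral], with [cap] for the two planes
    that are orthogonal to every other facet of the band. *)
Lemma lobell_gram a b : a <> b ->
  lorentz (e a) (e b) = 0 \/ lorentz (e a) (e b) <= - C.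
Proof.
have [x0 x0H x0lt] := interior_point cpt.
have W0 k : lorentz (W k) (W k) = 1 by exact: unit_normal.
have W1 k : lorentz (W k) (W k.+1) = 0 by apply/orth/lateral_adj1.
have W2 k : lorentz (W k) (W k.+2) = 0 by apply/orth/lateral_adj2.
have Wfar k j : (3 <= j)%N -> (j + 3 <= n.*2)%N -> lorentz (W k) (W (k + j)%N) < -1.
  by move=> j3 jn; have [h1 h2] := lateral_far n_gt0 k j3 jn; exact: far.
have W3 k : lorentz (W k) (W k.+3) < -1.
  by rewrite -(addn3 k); apply: Wfar; lia.
have W4 k : lorentz (W k) (W k.+4) < -1.
  by rewrite -(addn4 k); apply: Wfar; lia.
have W_per k : W (k + n.*2)%N = W k by rewrite /W lateral_per.
have P0 k : lorentz (P k) (P k) = 1 by exact: unit_normal.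
have P_per k : P k.+2 = P k by rewrite /P /cap /= negbK.
have PW0 k : lorentz (P k) (W k) < 0.
  apply: lt_trans (ltrN10 _); rewrite /P /W /cap /lateral.
  by case: (odd k); exact: far.
have PW1 k : lorentz (P k) (W k.+1) = 0.
  by rewrite /P /W /cap /lateral /=; case: (odd k) => /=; exact: orth.
have PW1' k : lorentz (P k.+1) (W k) = 0.
  by rewrite /P /W /cap /lateral /=; case: (odd k) => /=; exact: orth.
have p0 : (0 < n.*2)%N by lia.
have capd := band_cap_distance p0 W_per x0H (fun k => x0lt _) W0 W1 W2 W3 W4 P0 P_per PW0 PW1 PW1'.
have capl := band_cap_le p0 W_per x0H (fun k => x0lt _) W0 W1 W2 W3 W4 P0 P_per PW0 PW1 PW1' erefl n9 Wfar.
have farl := band_far_le p0 W_per x0H (fun k => x0lt _) W0 W1 W2 W3 W4 P_per PW0 PW1 PW1' erefl n9 Wfar.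
have c2 := band_cosh2_gt2 p0 W_per x0H (fun k => x0lt _) W0 W1 W2 W3 W4 P_per PW0 PW1 PW1'.
set c := band_cosh W 0 in capd capl farl c2.
have CE : C = c / (c ^+ 2 - 2).
  have cn0 : c ^+ 2 - 2 != 0 by rewrite gt_eqF // subr_gt0.
  apply: (mulIf cn0); rewrite divfK // /C mulNr.
  by have := capd 1%N; rewrite /P /cap /= => ->; rewrite opprK.
rewrite -CE in capl farl.
have capl' k : lorentz (P k) (W k) <= - C.
  have := capl (k + (n.*2).-1)%N; rewrite -addnS prednK // W_per.
  by rewrite /P /cap oddD odd_double addbF.
move=> ab; case: (boolP (lobell_adj a b)) => [/orth|/negbTE nadj]; [by left|right].
have top k : lobell_adj (@Top n) (lateral n_gt0 k) = false ->
    lorentz (e Top) (W k) <= - C.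
  by have := capl' k; rewrite /P /W /cap /lateral; case: (odd k).
have bot k : lobell_adj (@Bottom n) (lateral n_gt0 k) = false ->
    lorentz (e Bottom) (W k) <= - C.
  by have := capl' k; rewrite /P /W /cap /lateral; case: (odd k).
case: (lateralP n_gt0 a) ab nadj => [->|->|[j jn ->]].
- case: (lateralP n_gt0 b) => [->//|->|[k kn ->]] _; last exact: top.
  by rewrite /C opprK.
- case: (lateralP n_gt0 b) => [->|->//|[k kn ->]] _; last exact: bot.
  by rewrite /C opprK lorentzC.
case: (lateralP n_gt0 b) => [->|->|[k kn ->]] => [_|_|jk].
- by rewrite lobell_adjC lorentzC; exact: top.
- by rewrite lobell_adjC lorentzC; exact: bot.
move=> nadj.
have jNk : j != k by apply: contra_notN jk => /eqP ->.
have [x [d [d3 dn [[-> ->]|[-> ->]]]]] := lateral_nonadj jn kn jNk nadj.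
  exact: farl.
by rewrite lorentzC; exact: farl.
Qed.

Theorem lobell_systole :
  is_systole (reflection_group e) (2 * set_dist (face e Top) (face e Bottom)).
Proof.
have TB : @Top n <> Bottom by [].
have nadj : ~ Defs.adjacent e Top Bottom by rewrite adjE.
rewrite (set_dist_faces cpt lobell_right_angled TB nadj); split.
  exists (reflection (e Top) \o reflection (e Bottom)).
    by apply: generated_comp; apply: generated_mem; [exists Top|exists Bottom].
  exact: (loxodromic_reflections cpt lobell_right_angled TB nadj).
exact: (translation_length_ge cpt C1 lobell_gram).
Qed.

End Lobell.

Unset Implicit Arguments.

Theorem corollary1p1p1 (R : realType) :
  exists N : nat, forall n : nat, (5 <= n)%N -> (N <= n)%N ->
  forall e : lobell_face n -> 'rV[R]_4, lobell_polyhedron e ->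
  is_systole (reflection_group e) (2 * set_dist (face e Top) (face e Bottom)).
Proof.
by exists 9 => n _ n9 e; exact: lobell_systole.
Qed.
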